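(* Let $d>2$. Then for $-1\le u\le1$, $$m_{0,d}(u)=\frac{1}{(2\pi)^d}\int_{\mathbb{T}^d}M_{d-1}(u|\cos\theta_1,\ldots,\cos\theta_d)\,d\theta=\frac{\Gamma\left(\frac{d+1}{2}\right)}{\sqrt{\pi}\,\Gamma\left(\frac d2\right)(d-1)!}\,(1-u^2)^{\frac{d-2}{2}}.$$
   Context: $\mathbb{T}^d=(\mathbb{R}/2\pi\mathbb{Z})^d$. The function $m_{0,d}$ is defined by the first equality of the claim. Divided differences: for pairwise distinct real knots, $[x_0]f=f(x_0)$ and $[x_0,\ldots,x_m]f=\frac{[x_0,\ldots,x_{m-1}]f-[x_1,\ldots,x_m]f}{x_0-x_m}$; they are symmetric in the knots. B-spline: for $m\ge1$ and pairwise distinct $x_0,\ldots,x_m$, $M_m(u|x_0,\ldots,x_m)=[x_0,\ldots,x_m]\left\{\frac{(\cdot-u)_+^{m-1}}{(m-1)!}\right\}$, where $(x)_+^{k}=x^k$ if $x>0$ and $0$ otherwise. Thus $\theta\mapsto M_{d-1}(u|\cos\theta_1,\ldots,\cos\theta_d)$ is defined for almost every $\theta\in\mathbb{T}^d$. *)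

(* Defs.v *)
From HB Require Import structures.
From mathcomp Require Import all_boot all_order all_algebra.
From mathcomp Require Import all_classical all_reals all_analysis.

Set Implicit Arguments.
Unset Strict Implicit.
Unset Printing Implicit Defensive.

Import Order.TTheory GRing.Theory Num.Theory.
Import numFieldNormedType.Exports.

Local Open Scope classical_set_scope.
Local Open Scope ring_scope.

(* MathComp-Analysis has binary product measures only; the [n]-fold power of a
   sigma-finite measure is built by transporting [mu \x mu^n] from
   [T * n.-tuple T] to [n.+1.-tuple T]. *)
Section cons_measure.
Context d (T : measurableType d) (R : realType) (n : nat).
Variables (mu : {sigma_finite_measure set T -> \bar R})
          (nu : {sigma_finite_measure set (n.-tuple T) -> \bar R}).

Definition tuple_cons (p : T * n.-tuple T) : n.+1.-tuple T :=
  [tuple of p.1 :: p.2].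

Lemma measurable_tuple_cons : measurable_fun [set: T * n.-tuple T] tuple_cons.
Proof. exact: measurable_cons measurable_fst measurable_snd. Qed.

Definition cons_measure : set (n.+1.-tuple T) -> \bar R :=
  pushforward (mu \x nu)%E tuple_cons.

Let cons_measure0 : cons_measure set0 = 0%E.
Proof. by rewrite /cons_measure /pushforward preimage_set0 measure0. Qed.

Let cons_measure_ge0 A : (0 <= cons_measure A)%E.
Proof. exact: (measure_ge0 (mu \x nu)%E). Qed.

Let cons_measure_sigma_additive : semi_sigma_additive cons_measure.
Proof.
move=> F mF tF mUF; rewrite /cons_measure /pushforward preimage_bigcup.
have mpre X : measurable X -> measurable (tuple_cons @^-1` X).
  by move=> mX; rewrite -[X in measurable X]setTI; exact: measurable_tuple_cons.
apply: measure_semi_sigma_additive.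
- by move=> i; exact: mpre.
- apply/trivIsetP => /= i j _ _ ij; rewrite -preimage_setI.
  by move/trivIsetP : tF => /(_ _ _ _ _ ij) ->//; rewrite preimage_set0.
- by rewrite -preimage_bigcup; exact: mpre.
Qed.

HB.instance Definition _ := isMeasure.Build _ _ _ cons_measure
  cons_measure0 cons_measure_ge0 cons_measure_sigma_additive.

Lemma cons_measureX (A : set T) (B : set (n.-tuple T)) :
  measurable A -> measurable B ->
  cons_measure [set t | A (thead t) /\ B [tuple of behead t]] = (mu A * nu B)%E.
Proof.
move=> mA mB; rewrite -product_measure1E// /cons_measure /pushforward.
congr (product_measure1 _ _ _); apply/seteqP.
by split => -[x t] /= [Ax]; rewrite (_ : [tuple of _] = t) //; exact/val_inj.
Qed.

Let cons_measure_sigma_finite : sigma_finite setT cons_measure.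
Proof.
have /sigma_finiteP[F [TF ndF Foo]] := sigma_finiteT mu.
have /sigma_finiteP[G [TG ndG Goo]] := sigma_finiteT nu.
exists (fun i => [set t | F i (thead t) /\ G i [tuple of behead t]]).
  apply/seteqP; split => // t _.
  have : [set: T] (thead t) by [].
  rewrite TF => -[i _ Fi].
  have : [set: n.-tuple T] [tuple of behead t] by [].
  rewrite TG => -[j _ Gj]; exists (maxn i j) => //; split.
    by move: Fi; apply/subsetPset/ndF/leq_maxl.
  by move: Gj; apply/subsetPset/ndG/leq_maxr.
move=> i; have [mF Fioo] := Foo i; have [mG Gioo] := Goo i; split.
  apply: measurableI; rewrite -[X in measurable X]setTI.
    exact: (measurable_tnth ord0).
  exact: measurable_behead.
by rewrite cons_measureX// lte_mul_pinfty// ge0_fin_numE.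
Qed.

HB.instance Definition _ := Measure_isSigmaFinite.Build _ _ _ cons_measure
  cons_measure_sigma_finite.

End cons_measure.

Fixpoint power_measure d (T : measurableType d) (R : realType)
    (mu : {sigma_finite_measure set T -> \bar R}) (n : nat) :
    {sigma_finite_measure set (n.-tuple T) -> \bar R} :=
  match n with
  | 0 => \d_([tuple] : 0.-tuple T)
  | n'.+1 => cons_measure mu (power_measure mu n')
  end.

Lemma power_measure_box d (T : measurableType d) (R : realType)
    (mu : {sigma_finite_measure set T -> \bar R}) (n : nat) (A : 'I_n -> set T) :
  (forall i, measurable (A i)) ->
  measurable [set t : n.-tuple T | forall i, A i (tnth t i)] /\
  power_measure mu n [set t | forall i, A i (tnth t i)] =
  (\prod_(i < n) mu (A i))%E.
Proof.
elim: n A => [|n IHn] A mA.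
  rewrite (_ : mkset _ = setT); last by apply/seteqP; split => // t _ [].
  by split; [exact: measurableT|rewrite big_ord0 /= diracT].
have [mB muB] := IHn (fun i => A (lift ord0 i)) (fun i => mA _).
have -> : [set t : n.+1.-tuple T | forall i, A i (tnth t i)] =
    [set t | A ord0 (thead t) /\
      [set s : n.-tuple T | forall i, A (lift ord0 i) (tnth s i)]
        [tuple of behead t]].
  apply/seteqP; split => t /=.
    by move=> At; split => // i; rewrite tnth_behead (_ : inord _ = lift ord0 i) //;
      apply/val_inj; rewrite /= inordK // ltnS.
  move=> [A0 At] i; case: (unliftP ord0 i) => [j|] -> //.
  have := At j; rewrite tnth_behead (_ : inord _ = lift ord0 j) //.
  by apply/val_inj; rewrite /= inordK // ltnS.
split; last by rewrite big_ord_recl -muB; exact: cons_measureX.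
apply: measurableI; rewrite -[X in measurable X]setTI.
  exact: (measurable_tnth ord0).
exact: measurable_behead.
Qed.

Definition lebesgue_tuple (R : realType) (n : nat) :
    {sigma_finite_measure set (n.-tuple (measurableTypeR R)) -> \bar R} :=
  power_measure (@lebesgue_measure R) n.

(* A fundamental domain of the torus (R / 2 pi Z)^n. *)
Definition torus (R : realType) (n : nat) :
    set (n.-tuple (measurableTypeR R)) :=
  [set t | forall i, tnth t i \in `[0, 2 * pi[].
Arguments torus R n : clear implicits.

(* [divided_difference f m x] is [x_0, ..., x_m]f; only [x 0], ..., [x m]
   matter. It is total: [/ 0 = 0] gives it a meaningless value when two of these
   knots coincide. *)
Fixpoint divided_difference (R : fieldType) (f : R -> R) (m : nat)
    (x : nat -> R) : R :=
  match m with
  | 0 => f (x 0%N)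
  | m'.+1 => (divided_difference f m' x
               - divided_difference f m' (fun i => x i.+1))
             / (x 0%N - x m'.+1)
  end.

(* For [k = 0] this is 0 at [x = 0], unlike [Num.max 0 x ^+ k]. *)
Definition truncated_power (R : realType) (k : nat) (x : R) : R :=
  if 0 < x then x ^+ k else 0.

Definition bspline (R : realType) (m : nat) (x : nat -> R) (u : R) : R :=
  divided_difference (fun y => truncated_power m.-1 (y - u) / (m.-1)`!%:R) m x.

(* The knots are cos theta_1, ..., cos theta_d. They are pairwise distinct for
   almost every theta, so the junk values of [bspline] do not matter. The value
   is kept in [\bar R], so that it is infinite when the integral is. *)
Definition m0 (R : realType) (d : nat) (u : R) : \bar R :=
  (((2 * pi) ^- d)%:E *
   \int[lebesgue_tuple R d]_(theta in torus R d)
     (bspline d.-1 (fun i => cos (nth 0%R theta i)) u)%:E)%E.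

Definition Gamma (R : realType) (x : R) : R :=
  \int[lebesgue_measure]_(t in `]0, +oo[) (t `^ (x - 1) * expR (- t)).

(* Main.v *)
From HB Require Import structures.
Require Import Defs.
From mathcomp Require Import all_boot all_order all_algebra.
From mathcomp Require Import all_classical all_reals all_analysis.
From mathcomp Require Import measurable_realfun ring lra.

Import Order.TTheory GRing.Theory Num.Theory.
Import numFieldNormedType.Exports.

Set Implicit Arguments.
Unset Strict Implicit.
Unset Printing Implicit Defensive.

Local Open Scope classical_set_scope.
Local Open Scope ring_scope.

(** The B-spline with knots [x_1, ..., x_d], multiplied by [(d-1)!], is the density
    of [sum_i r_i x_i] for [(r_1, ..., r_d)] uniform on the simplex.
    Take [x_i = cos t_i] and let [(s_i, w_i)] be the planar point whose square,
    as a complex number, is [2 r_i exp(i t_i)]. Up to constants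
    [dr_i dt_i = ds_i dw_i], while [s_i^2 = r_i (1 + cos t_i)] and
    [w_i^2 = r_i (1 - cos t_i)]. The two constraints [sum_i r_i = 1] and
    [sum_i r_i cos t_i = u] therefore say that [s] and [w] lie on two independent
    spheres of R^d, of radii [sqrt (1 + u)] and [sqrt (1 - u)], and this product
    has measure proportional to [((1 + u) (1 - u))^((d-2)/2)].

    The proof carries this out one angle at a time. Peeling off the first knot
    ([bspline_recursion]) writes a B-spline as the average over [0 < r < 1] of
    rescaled B-splines in the other knots. As B-splines are nonnegative,
    Tonelli's theorem lets the angles be integrated in any order
    ([torus_bspline_recursion]), so it is enough to average the candidate
    [(1 - v^2)_+^(n/2)] over one angle and one weight. The variable
    [x = - cot (t/2)] is the ratio [s/w] up to sign; in this variable
    the dependence on [u] is a mere dilation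
    ([averaged_weight_shape], and [torus_bspline2_shape] for two knots, where
    the induction starts), which gives the shape [(1 - u^2)^((d-2)/2)].

    The constant is found from total masses only: at each stage the integral
    over [u] is known, and [int (1 - u^2)_+^(n/2) du] is a quotient of Gamma
    values ([weight_mass_gamma]). Since a divided difference is a junk value
    when two knots coincide, everything is done with angles of pairwise distinct
    cosines, which is almost every angle ([integral_nongeneric]). *)

(** * Change of variables for Borel functions *)

Section ge0_integral_transfer.
Local Open Scope ereal_scope.
Context {R : realType}.
Let mu := @lebesgue_measure R.

Lemma ge0_integral_mrestr d (X : measurableType d)
    (m : {measure set X -> \bar R}) (E : set X) (mE : measurable E)
    (f : X -> \bar R) :
  measurable_fun setT f -> (forall x, 0 <= f x) ->
  \int[mrestr m mE]_x f x = \int[m]_(x in E) f x.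
Proof.
move=> mf f0.
rewrite (@ge0_negligible_integral _ _ _ (mrestr m mE) setT (~` E))//.
- rewrite setTD setCK; apply: eq_measure_integral => A mA AE.
  by rewrite /= /mrestr setIidl.
- exact: measurableC.
- by rewrite /= /mrestr setICl measure0.
Qed.

(** Integrals of [f (p x)] only see the image measure of [p], and locally finite
    measures on the line that agree on half-open intervals are equal. *)
Lemma ge0_integral_transfer d1 d2 (X1 : measurableType d1)
    (X2 : measurableType d2) (m1 : {measure set X1 -> \bar R})
    (m2 : {measure set X2 -> \bar R}) (E1 : set X1) (E2 : set X2)
    (p1 : X1 -> measurableTypeR R) (p2 : X2 -> measurableTypeR R) (f : R -> \bar R) :
  measurable E1 -> measurable E2 ->
  measurable_fun setT p1 -> measurable_fun setT p2 ->
  (forall a b : R, (a < b)%R -> m1 (E1 `&` p1 @^-1` `]a, b]) < +oo) ->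
  (forall a b : R, (a < b)%R ->
    m1 (E1 `&` p1 @^-1` `]a, b]) = m2 (E2 `&` p2 @^-1` `]a, b])) ->
  measurable_fun setT f -> (forall x, 0 <= f x) ->
  \int[m1]_(x in E1) f (p1 x) = \int[m2]_(x in E2) f (p2 x).
Proof.
move=> mE1 mE2 mp1 mp2 fin12 eq12 mf f0.
have pushE d (X : measurableType d) (m : {measure set X -> \bar R})
    (E : set X) (mE : measurable E) (p : X -> measurableTypeR R)
    (mp : measurable_fun setT p) :
  \int[m]_(x in E) f (p x) = \int[pushforward (mrestr m mE) p]_y f y.
  rewrite [RHS]ge0_integral_pushforward//= preimage_setT ge0_integral_mrestr//.
  exact: measurableT_comp.
rewrite (pushE _ _ m1 _ mE1)// (pushE _ _ m2 _ mE2)//.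
pose M1 : {measure set X1 -> \bar R} := mrestr m1 mE1.
pose M2 : {measure set X2 -> \bar R} := mrestr m2 mE2.
pose q1 : {mfun X1 >-> measurableTypeR R} := HB.pack p1 (isMeasurableFun.Build _ _ _ _ p1 mp1).
pose q2 : {mfun X2 >-> measurableTypeR R} := HB.pack p2 (isMeasurableFun.Build _ _ _ _ p2 mp2).
apply: eq_measure_integral => A mA _.
have mG : @measurable _ (measurableTypeR R) = <<s @ocitv R >> by [].
have Gg i : ocitv `](- i%:R : R)%R, i%:R%R]%classic by exact: is_ocitv.
have gT : \bigcup_i `](- i%:R : R)%R, i%:R%R]%classic = setT.
  rewrite -subTset => /= x _ /=; exists (Num.bound `|x|%R) => //=.
  have := archi_boundP (normr_ge0 x); rewrite ltr_norml => /andP[xl xr].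
  by rewrite in_itv/= xl ltW.
apply: (measure_unique _ _ mG (@ocitvI R) Gg gT (pushforward M1 q1) (pushforward M2 q2)).
- move=> _ [[a b] _ <-] /=; rewrite /pushforward /M1 /M2 /= /mrestr.
  have [ab|ba] := ltP a b; last first.
    by rewrite set_itv_ge ?bnd_simp -?leNgt// !preimage_set0 !set0I !measure0.
  have -> : p1 @^-1` `]a, b] `&` E1 = E1 `&` p1 @^-1` `]a, b] by exact: setIC.
  by rewrite eq12//; congr (m2 _); exact: setIC.
- move=> k; have [k0|k0] := ltP (- k%:R : R)%R k%:R; last first.
    by rewrite set_itv_ge ?bnd_simp -?leNgt// measure0.
  by have := fin12 _ _ k0; rewrite setIC; exact.
- exact: mA.
Qed.

(** A density [w] is the image of the area measure of the region below its graph
    under the first projection; this makes [ge0_integral_transfer] applicable to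
    measures given by densities. *)
Lemma ge0_integral_hypograph (w : R -> R) (g : R -> \bar R) :
  measurable_fun setT w -> (forall x, 0 <= w x)%R ->
  measurable_fun setT g -> (forall x, 0 <= g x) ->
  measurable [set z : measurableTypeR R * measurableTypeR R | (0 <= z.2 < w z.1)%R] /\
  \int[mu \x mu]_(z in [set z | (0 <= z.2 < w z.1)%R]) g z.1 =
  \int[mu]_x (g x * (w x)%:E).
Proof.
move=> mw w0 mg g0; set H := mkset _.
have mH : measurable H.
  have -> : H = (fun z : measurableTypeR R * measurableTypeR R => (0 <= z.2)%R) @^-1` [set true] `&`
      (fun z => (z.2 < w z.1)%R) @^-1` [set true].
    by apply/seteqP; split => z; rewrite /H /=; [move=> /andP[]|move=> [-> ->]].
  have m1 : measurable_fun setT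
      (fun z : measurableTypeR R * measurableTypeR R => (0 <= z.2)%R).
    by apply: measurable_fun_ler => //; exact: measurable_snd.
  have m2 : measurable_fun setT
      (fun z : measurableTypeR R * measurableTypeR R => (z.2 < w z.1)%R).
    apply: measurable_fun_ltr; first exact: measurable_snd.
    by apply: measurableT_comp mw _; exact: measurable_fst.
  apply: measurableI; rewrite -[X in measurable X]setTI; first exact: m1.
  exact: m2.
split => //.
rewrite integral_mkcond fubini_tonelli1/=; last 2 first.
- apply/(measurable_restrictT _ mH)/measurable_funTS.
  by apply: measurableT_comp mg _; exact: measurable_fst.
- by move=> z; rewrite patchE; case: ifP.
apply: eq_integral => x _; rewrite /fubini_F.
transitivity (\int[mu]_y (g x * (\1_`[0%R, w x[%classic y)%:E)).
  apply: eq_integral => y _; rewrite patchE indicE.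
  rewrite (_ : ((x, y) \in H) = (y \in `[0%R, w x[%classic)).
    by case: ifP => _ /=; rewrite ?mule1 ?mule0.
  by apply/idP/idP => /set_mem zH; apply/mem_set; move: zH; rewrite /H /= in_itv.
rewrite ge0_integralZl//; last exact/measurable_EFinP.
rewrite integral_indic// setIT /= lebesgue_measure_itv/= lte_fin.
have := w0 x; rewrite le_eqVlt => /predU1P[<-|->]; last by rewrite sube0.
by rewrite ltxx.
Qed.

(** Change of variables for all nonnegative Borel [f]: continuity would not do,
    since the integrands below jump or are themselves integrals. *)
Lemma ge0_integral_density (E : set R) (p w : R -> R) (f : R -> \bar R) :
  measurable E -> measurable_fun setT p ->
  measurable_fun setT w -> (forall x, 0 <= w x)%R ->
  (forall a b : R, (a < b)%R -> \int[mu]_(x in `]a, b]) (w x)%:E < +oo) ->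
  (forall a b : R, (a < b)%R ->
    mu (E `&` p @^-1` `]a, b]) = \int[mu]_(x in `]a, b]) (w x)%:E) ->
  measurable_fun setT f -> (forall x, 0 <= f x) ->
  \int[mu]_(x in E) f (p x) = \int[mu]_x (f x * (w x)%:E).
Proof.
move=> mE mp mw w0 fin eqw mf f0.
have [mH <-] := ge0_integral_hypograph mw w0 mf f0.
apply: ge0_integral_transfer => //.
  by move=> a b ab; have := fin _ _ ab; rewrite -eqw.
move=> a b ab; apply: (eq_trans (eqw _ _ ab)).
have mi : measurable_fun setT (EFin \o (\1_(`]a, b]%classic) : R -> R)).
  exact/measurable_EFinP.
have i0 (x : R) : 0 <= (EFin \o (\1_(`]a, b]%classic) : R -> R)) x.
  by rewrite /= lee_fin.
transitivity (\int[mu]_x ((EFin \o (\1_(`]a, b]%classic) : R -> R)) x * (w x)%:E)).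
  rewrite [LHS]integral_mkcond epatch_indic.
  by apply: eq_integral => x _; rewrite muleC.
rewrite -(ge0_integral_hypograph mw w0 mi i0).2.
set H := [set z | _] in mH *.
pose fstR := (fst : measurableTypeR R * measurableTypeR R -> R).
have mfst : measurable (fstR @^-1` `]a, b]).
  by rewrite -[X in measurable X]setTI; exact: measurable_fst.
rewrite [RHS](_ : _ = (mu \x mu) ((fstR @^-1` `]a, b]) `&` H)).
  by rewrite -integral_indic//; apply: eq_integral => z _; rewrite /= !indicE.
by congr (_ _); exact: setIC.
Qed.

End ge0_integral_transfer.

Section affine_substitution.
Local Open Scope ereal_scope.
Context {R : realType}.
Let mu := @lebesgue_measure R.

Lemma measurable_invr : measurable_fun [set: R] (fun x : R => x^-1)%R.
Proof.
(* [x^-1 = x (x^2)^-1] holds at [0] too, and powers of a nonnegative base are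
   measurable. *)
rewrite (_ : (fun x => _) = (fun x : R => x * (x ^+ 2) `^ (-1))%R).
  apply: measurable_funM => //; apply: measurableT_comp (measurable_powR _) _.
  exact: exprn_measurable.
apply/funext => x; rewrite powR_inv1 ?sqr_ge0//.
by have [->|x0] := eqVneq x 0%R; [rewrite invr0 mul0r|field].
Qed.

Lemma measurable_fun_inv d (X : measurableType d) (f : X -> R) :
  measurable_fun setT f -> measurable_fun setT (fun x => (f x)^-1)%R.
Proof. exact: measurableT_comp measurable_invr. Qed.

Lemma ge0_integral_affine (a b : R) (f : R -> \bar R) : (a != 0)%R ->
  measurable_fun setT f -> (forall x, 0 <= f x) ->
  \int[mu]_x f (a * x + b)%R = (`|a|^-1)%:E * \int[mu]_x f x.
Proof.
move=> a0 mf f0.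
have ma : measurable_fun setT (fun x : R => a * x + b)%R.
  by apply: measurable_funD => //; exact: mulrl_measurable.
rewrite -ge0_integralZl//.
under [RHS]eq_integral do rewrite muleC.
have Ic p q : (p < q)%R -> \int[mu]_(x in `]p, q]) (`|a|^-1)%:E =
    (`|a|^-1 * (q - p))%:E.
  move=> pq; rewrite -[LHS]/(\int[mu]_(x in `]p, q]) cst (`|a|^-1)%:E x).
  by rewrite integral_cst//= lebesgue_measure_itv/= lte_fin pq -EFinB -EFinM.
apply: (@ge0_integral_density _ setT (fun x => a * x + b)%R (cst `|a|^-1%R)) => //.
- by move=> x; rewrite /= invr_ge0.
- by move=> p q pq; rewrite /= Ic// ltry.
- move=> p q pq; rewrite setTI /= Ic//.
  have [a_gt0|a_lt0|a_eq0] := ltgtP a 0%R; last by rewrite a_eq0 eqxx in a0.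
    rewrite (_ : _ @^-1` _ = `[((q - b) / a)%R, ((p - b) / a)%R[%classic).
      rewrite lebesgue_measure_itv/= lte_fin ltr_nM2r ?invr_lt0// ltrD2r pq.
      by rewrite -EFinB ltr0_norm//; congr EFin; field.
    apply/seteqP; split => x /=; rewrite !in_itv/=.
      by rewrite ler_ndivrMr// ltr_ndivlMr// lerBrDr ltrBlDr mulrC andbC.
    by rewrite ler_ndivrMr// ltr_ndivlMr// lerBrDr ltrBlDr mulrC andbC.
  rewrite (_ : _ @^-1` _ = `]((p - b) / a)%R, ((q - b) / a)%R]%classic).
    rewrite lebesgue_measure_itv/= lte_fin ltr_pM2r ?invr_gt0// ltrD2r pq.
    by rewrite -EFinB gtr0_norm//; congr EFin; field.
  by apply/seteqP; split => x /=; rewrite !in_itv/=;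
    rewrite ler_pdivlMr// ltr_pdivrMr// lerBrDr ltrBlDr mulrC.
Qed.

End affine_substitution.

(** * The half-angle substitution *)

Section half_angle_substitution.
Local Open Scope ereal_scope.
Context {R : realType}.
Let mu := @lebesgue_measure R.

Lemma integral_cauchy_itv (a b : R) : (a < b)%R ->
  \int[mu]_(x in `]a, b]) (2 / (1 + x ^+ 2))%:E = (2 * atan b - 2 * atan a)%:E.
Proof.
move=> ab; rewrite integral_itv_obnd_cbnd; last first.
  apply/measurable_EFinP/measurable_funTS/measurable_funM => //.
  by apply: measurable_fun_inv; exact: measurable_funD.
rewrite (@continuous_FTC2 _ _ (fun x => 2 * atan x)%R)//.
- apply: continuous_in_subspaceT => x _; apply: cvgM; first exact: cvg_cst.
  apply: (@continuousV _ _ _ x); first by rewrite gt_eqF// ltr_pwDl// sqr_ge0.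
  apply: cvgD; [exact: cvg_cst|exact: exprn_continuous].
- split.
  + by move=> x _; apply: derivableM => //; exact: derivable_atan.
  + by apply: cvg_at_right_filter; apply: cvgM; [exact: cvg_cst|exact: continuous_atan].
  + by apply: cvg_at_left_filter; apply: cvgM; [exact: cvg_cst|exact: continuous_atan].
- move=> x _; rewrite derive1E deriveM//=.
  by rewrite derive_val derive_cst scaler0 addr0.
Qed.

(** [- cot (t / 2)] *)
Let p (t : R) : R := tan (t / 2 - pi / 2).

Lemma cos_half_angle t : (0 < t < 2 * pi)%R ->
  cos t = ((p t ^+ 2 - 1) / (p t ^+ 2 + 1))%R.
Proof.
move=> /andP[t0 t2]; rewrite /p; set h := (t / 2 - pi / 2)%R.
have ch : (0 < cos h)%R by apply: cos_gt0_pihalf; rewrite /h; lra.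
have -> : t = (h *+ 2 + pi)%R by rewrite /h mulr2n; lra.
rewrite cosDpi cos_mulr2n.
have E : (tan h ^+ 2 = cos h ^- 2 - 1)%R.
  by rewrite cos2_tan2 ?gt_eqF//; ring.
rewrite E; move: (cos h) ch => c c0; have c1 : (c != 0)%R by rewrite gt_eqF.
by field; rewrite c1 mulN1r subrK oner_neq0.
Qed.

(** In the variable [x = - cot (t / 2)], [1 - cos t] and [1 + cos t] are
    [2 / (1 + x^2)] and [2 x^2 / (1 + x^2)], so that [x] enters only through
    [x^2] once the common factor is absorbed. *)
Lemma ge0_integral_cos (F : R -> \bar R) :
  measurable_fun setT F -> (forall x, 0 <= F x) ->
  \int[mu]_(t in `[0%R, (2 * pi)%R[) F (cos t) =
  \int[mu]_x (F ((x ^+ 2 - 1) / (x ^+ 2 + 1))%R * (2 / (1 + x ^+ 2))%:E).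
Proof.
move=> mF F0.
have mFc : measurable_fun setT (F \o cos).
  exact: measurableT_comp mF (continuous_measurable_fun (@continuous_cos R)).
have mc : measurable_fun [set: R] (fun x => (x ^+ 2 - 1) / (x ^+ 2 + 1))%R.
  apply: measurable_funM; first exact: measurable_funB.
  by apply: measurable_fun_inv; exact: measurable_funD.
rewrite -integral_itv_obnd_cbnd; last exact: measurable_funTS.
transitivity (\int[mu]_(t in `]0%R, (2 * pi)%R[)
    (F \o (fun x => (x ^+ 2 - 1) / (x ^+ 2 + 1))%R) (p t)).
  by apply: eq_integral => t /set_mem /=; rewrite in_itv/= => /cos_half_angle <-.
apply: ge0_integral_density => //.
- rewrite /p; apply: (@measurableT_comp _ _ _ _ _ _ tan).
    apply: measurable_funM; first exact: continuous_measurable_fun (@continuous_sin R).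
    exact: measurable_fun_inv (continuous_measurable_fun (@continuous_cos R)).
  by apply: measurable_funB => //; exact: measurable_funM.
- apply: measurable_funM => //.
  by apply: measurable_fun_inv; exact: measurable_funD.
- by move=> x; rewrite divr_ge0// addr_ge0// sqr_ge0.
- by move=> a b ab; rewrite integral_cauchy_itv// ltry.
- move=> a b ab; rewrite integral_cauchy_itv//.
  rewrite (_ : _ `&` _ = `](pi + 2 * atan a)%R, (pi + 2 * atan b)%R]%classic).
    rewrite lebesgue_measure_itv/= lte_fin ltrD2l ltr_pM2l// lt_atan//.
    by rewrite -EFinB; congr EFin; ring.
  have pi0 := pi_gt0 R.
  have tanlt (c t : R) : (0 < t < 2 * pi)%R -> (c < p t)%R = (pi + 2 * atan c < t)%R.
    move=> t2; rewrite /p -{1}(atanK c) ltr_tan ?in_itv/=; last 2 first.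
    - by rewrite atan_gtNpi2 atan_ltpi2.
    - by lra.
    by lra.
  apply/seteqP; split => t /=; rewrite !in_itv/=.
    move=> [t2]; rewrite tanlt// => /andP[-> /=].
    by rewrite !leNgt tanlt.
  move=> /andP[at_ tb].
  have t2 : (0 < t < 2 * pi)%R.
    have := atan_gtNpi2 a; have := atan_ltpi2 b; lra.
  by split => //; rewrite tanlt// at_/= leNgt tanlt// -leNgt.
- exact: measurableT_comp mF mc.
- by move=> x; exact: F0.
Qed.

End half_angle_substitution.

(** * Truncated half-integer powers *)

Section tonelli_on_sets.
Local Open Scope ereal_scope.
Context {R : realType} d1 d2 (X : measurableType d1) (Y : measurableType d2).
Variables (m1 : {sigma_finite_measure set X -> \bar R})
          (m2 : {sigma_finite_measure set Y -> \bar R}).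
Variables (D : set X) (E : set Y) (f : X * Y -> \bar R).
Hypotheses (mD : measurable D) (mE : measurable E).
Hypotheses (mf : measurable_fun setT f) (f0 : forall z, 0 <= f z).

Let fE := f \_ (snd @^-1` E).

Let mpreD : measurable (fst @^-1` D : set (X * Y)).
Proof. by rewrite -[X in measurable X]setTI; exact: measurable_fst. Qed.

Let mpreE : measurable (snd @^-1` E : set (X * Y)).
Proof. by rewrite -[X in measurable X]setTI; exact: measurable_snd. Qed.

Let mfE : measurable_fun setT fE.
Proof. exact/(measurable_restrictT _ mpreE)/measurable_funTS. Qed.

Let fE0 z : 0 <= fE z.
Proof. by rewrite /fE patchE; case: ifP. Qed.

Let integral_fE x : \int[m2]_(y in E) f (x, y) = \int[m2]_y fE (x, y).
Proof.
rewrite integral_mkcond; apply: eq_integral => y _; rewrite /fE !patchE.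
by rewrite (_ : ((x, y) \in _) = (y \in E)).
Qed.

Lemma measurable_integral_in :
  measurable_fun setT (fun x => \int[m2]_(y in E) f (x, y)).
Proof.
under eq_fun do rewrite integral_fE.
exact: (measurable_fun_fubini_tonelli_F fE).
Qed.

Lemma tonelli_in : \int[m1]_(x in D) \int[m2]_(y in E) f (x, y) =
  \int[m2]_(y in E) \int[m1]_(x in D) f (x, y).
Proof.
pose fDE := fE \_ (fst @^-1` D).
have mfDE : measurable_fun setT fDE.
  exact/(measurable_restrictT _ mpreD)/measurable_funTS.
have fDE0 z : 0 <= fDE z by rewrite /fDE patchE; case: ifP.
transitivity (\int[m1]_x \int[m2]_y fDE (x, y)).
  rewrite integral_mkcond; apply: eq_integral => x _; rewrite patchE.
  rewrite integral_fE; case: ifPn => xD; last first.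
    rewrite integral0_eq// => y _; rewrite /fDE patchE.
    by rewrite (_ : ((x, y) \in _) = (x \in D)) // (negbTE xD).
  apply: eq_integral => y _; rewrite /fDE patchE.
  by rewrite (_ : ((x, y) \in _) = (x \in D)) // xD.
rewrite fubini_tonelli// [RHS]integral_mkcond.
apply: eq_integral => y _; rewrite patchE; case: ifPn => yE; last first.
  rewrite integral0_eq// => x _; rewrite /fDE /fE !patchE.
  by rewrite (_ : ((x, y) \in snd @^-1` E) = (y \in E)) // (negbTE yE) if_same.
rewrite [RHS]integral_mkcond; apply: eq_integral => x _.
rewrite /fDE /fE !patchE (_ : ((x, y) \in snd @^-1` E) = (y \in E)) // yE.
by rewrite (_ : ((x, y) \in _) = (x \in D)).
Qed.

End tonelli_on_sets.

Section half_power.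
Context {R : realType}.
Implicit Types (a b x u : R) (n : nat).

Lemma measurable_truncated_power n :
  measurable_fun [set: R] (@truncated_power R n).
Proof.
by apply: measurable_fun_ifT => //; exact: measurable_fun_ltr.
Qed.

(** [x_+^(n/2)]: the square root is [0] on negative numbers, and for [n = 0] the
    truncated power is the indicator of [0 < x]. *)
Definition half_power n x := truncated_power n (Num.sqrt x).

Lemma half_power_gt0E n x : 0 < x -> half_power n x = Num.sqrt x ^+ n.
Proof. by move=> x0; rewrite /half_power /truncated_power sqrtr_gt0 x0. Qed.

Lemma half_power_le0 n x : x <= 0 -> half_power n x = 0.
Proof.
by move=> x0; rewrite /half_power /truncated_power sqrtr_gt0 ltNge x0.
Qed.

Lemma half_power_ge0 n x : 0 <= half_power n x.
Proof.
have [x0|x0] := leP x 0; first by rewrite half_power_le0.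
by rewrite half_power_gt0E// exprn_ge0// sqrtr_ge0.
Qed.

Lemma half_powerM n a b : 0 < a ->
  half_power n (a * b) = half_power n a * half_power n b.
Proof.
move=> a0; have [b0|b0] := leP b 0.
  by rewrite (@half_power_le0 _ b)// mulr0 half_power_le0// pmulr_rle0.
by rewrite !half_power_gt0E ?mulr_gt0// sqrtrM 1?ltW// exprMn.
Qed.

(** The factor [(1 - r)^n] of the recursion thus splits evenly between the two
    factors of the weight. *)
Lemma half_power_sqr n a : half_power n a * half_power n a = truncated_power n a.
Proof.
rewrite /truncated_power; have [a0|a0] := ltP 0 a.
  by rewrite half_power_gt0E// -exprMn -expr2 sqr_sqrtr// ltW.
by rewrite half_power_le0// mul0r.
Qed.

Lemma measurable_half_power d (X : measurableType d) (f : X -> R) n :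
  measurable_fun setT f -> measurable_fun setT (fun z => half_power n (f z)).
Proof.
move=> mf; apply: (measurableT_comp (measurable_truncated_power n)).
apply: (@measurableT_comp _ _ _ _ _ _ (@Num.sqrt R)) => //.
exact: continuous_measurable_fun (@sqrt_continuous R).
Qed.

(** [(1 - u^2)_+^(n/2)], kept as a product because the two factors are rescaled
    separately. *)
Definition gegenbauer_weight n u := half_power n (1 - u) * half_power n (1 + u).

Lemma gegenbauer_weight_ge0 n u : 0 <= gegenbauer_weight n u.
Proof. by rewrite mulr_ge0// half_power_ge0. Qed.

Lemma measurable_gegenbauer_weight n :
  measurable_fun [set: R] (gegenbauer_weight n).
Proof.
apply: measurable_funM; apply: measurable_half_power.
  exact: measurable_funB.
exact: measurable_funD.
Qed.

(** The form in which the weight of the remaining knots enters the average over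
    the weight [r] of a knot at [c]. *)
Lemma gegenbauer_weight_slice n u c r : (0 < r < 1)%R ->
  ((1 - r) ^+ n * gegenbauer_weight n ((u - r * c) / (1 - r)) =
   half_power n (1 - u - (1 - c) * r) * half_power n (1 + u - (1 + c) * r))%R.
Proof.
move=> /andP[r0 r1]; have s0 : (0 < 1 - r)%R by rewrite subr_gt0.
have s1 : (1 - r != 0)%R by rewrite gt_eqF.
have -> : ((1 - r) ^+ n = half_power n (1 - r) * half_power n (1 - r))%R.
  by rewrite half_power_sqr /truncated_power s0.
rewrite /gegenbauer_weight mulrACA -(half_powerM n (1 - _)%R s0).
rewrite -(half_powerM n (1 + _)%R s0).
by congr (half_power n _ * half_power n _)%R; field.
Qed.

(** The two bases add up to [2 (1 - r)], so one of them is nonpositive. This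
    lets [r] range over the whole half-line. *)
Lemma half_power_slice_out n u c r : (1 <= r)%R ->
  (half_power n (1 - u - (1 - c) * r) * half_power n (1 + u - (1 + c) * r) = 0)%R.
Proof.
move=> r1; have [u1|u1] := leP (1 - u - (1 - c) * r)%R 0%R.
  by rewrite (half_power_le0 n u1) mul0r.
have u2 : (1 + u - (1 + c) * r <= 0)%R.
  have : (1 - u - (1 - c) * r + (1 + u - (1 + c) * r) = 2 * (1 - r))%R by ring.
  by lra.
by rewrite (half_power_le0 n u2) mulr0.
Qed.

End half_power.

(** * One angle and one weight: the averaging step *)

(** Decides measurability from the syntax of the body: unification alone would
    try to unfold arithmetic. *)
Ltac measurable_real := lazymatch goal with
  | |- measurable_fun _ (fun x => EFin _) => apply/measurable_EFinP; measurable_real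
  | |- measurable_fun _ (fun x => half_power _ _) =>
      apply: measurable_half_power; measurable_real
  | |- measurable_fun _ (half_power _) => exact: (@measurable_half_power _ _ _ id)
  | |- measurable_fun _ (fun x => (_ - _)%R) => apply: measurable_funB; measurable_real
  | |- measurable_fun _ (fun x => (_ + _)%R) => apply: measurable_funD; measurable_real
  | |- measurable_fun _ (fun x => (_ * _)%R) => apply: measurable_funM; measurable_real
  | |- measurable_fun _ (fun x => (_ ^+ _)%R) => apply: measurable_funX; measurable_real
  | |- measurable_fun _ (GRing.add ?a) =>
      apply: (@measurable_funD _ _ _ _ (cst a) id); [exact: measurable_cst|exact: measurable_id]
  | |- measurable_fun _ (fun x => fst x) => exact: measurable_fst
  | |- measurable_fun _ (fun x => snd x) => exact: measurable_snd
  | |- _ => try by []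
  end.

Section sphere_integral.
Local Open Scope ereal_scope.
Context {R : realType}.
Let mu := @lebesgue_measure R.
Implicit Types (a b u c : R) (n : nat).

Let integrand n (p q a b r : R) : R :=
  (half_power 0 r * (half_power n (p - a * r) * half_power n (q - b * r)))%R.

Let integrand_ge0 n p q a b r : (0 <= integrand n p q a b r)%R.
Proof. by rewrite !mulr_ge0// half_power_ge0. Qed.

(** If [v |-> gegenbauer_weight n v] is the average for the other knots, this is the
    average with one more knot at [cos t], of weight [r]: see
    [gegenbauer_weight_slice]. *)
Definition averaged_weight n u : \bar R :=
  \int[mu]_(t in `[0%R, (2 * pi)%R[) \int[mu]_r
    (half_power 0 r * (half_power n (1 - u - (1 - cos t) * r)
                       * half_power n (1 + u - (1 + cos t) * r)))%:E.

(** Rescaling [r] by [(1 + x^2) / 2] cancels the density [2 / (1 + x^2)] of the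
    half-angle substitution. *)
Lemma averaged_weight_cauchy n u : averaged_weight n u =
  \int[mu]_x \int[mu]_r
    (half_power 0 r * (half_power n (1 - u - 1 * r)
                       * half_power n (1 + u - x ^+ 2 * r)))%:E.
Proof.
pose F c := \int[mu]_r (integrand n (1 - u) (1 + u) (1 - c) (1 + c) r)%:E.
have mF : measurable_fun setT F.
  apply: (@measurable_integral_in _ _ _ R (measurableTypeR R) mu setT
    (fun z => (integrand n (1 - u) (1 + u) (1 - z.1) (1 + z.1) z.2)%:E)) => //.
  - by rewrite /integrand; measurable_real.
  - by move=> z; rewrite lee_fin integrand_ge0.
have F0 c : 0 <= F c.
  by apply: integral_ge0 => r _; rewrite lee_fin integrand_ge0.
apply: (eq_trans (ge0_integral_cos mF F0)); apply: eq_integral => x _.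
have x1 : (0 < 1 + x ^+ 2)%R by rewrite ltr_pwDl// sqr_ge0.
have x1' : (x ^+ 2 + 1 != 0)%R by rewrite addrC gt_eqF.
have x2 : (0 < (1 + x ^+ 2) / 2)%R by rewrite divr_gt0.
(* [c] is the cosine of the angle with half-angle coordinate [x]. *)
set c := ((x ^+ 2 - 1) / (x ^+ 2 + 1))%R.
rewrite muleC /F -[X in X%:E](_ : `|(1 + x ^+ 2) / 2|^-1 = _)%R; last first.
  by rewrite gtr0_norm// invf_div.
rewrite -(@ge0_integral_affine _ _ 0%R) ?gt_eqF//.
- apply: eq_integral => r _; rewrite /integrand addr0 half_powerM//.
  rewrite (@half_power_gt0E _ 0%N ((1 + x ^+ 2) / 2))// expr0 !mul1r.
  congr (_ * (half_power n _ * half_power n _))%:E.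
    by rewrite /c; field.
  by rewrite /c; field.
- by rewrite /integrand; measurable_real.
- by move=> r; rewrite lee_fin integrand_ge0.
Qed.

(** With [A = 1 - u] and [B = 1 + u], dilating [r] by [A] and [x] by [sqrt (B / A)]
    takes both factors out: what is left does not depend on [u], and the
    Jacobian [A sqrt (B / A) = sqrt A sqrt B] raises the exponent from [n / 2] to
    [(n + 1) / 2]. *)
Lemma averaged_weight_shape n u :
  averaged_weight n u = (gegenbauer_weight n.+1 u)%:E * averaged_weight n 0.
Proof.
have [u1|u1] := leP 1%R u.
  rewrite [X in X * _](_ : _ = 0); last first.
    by rewrite /gegenbauer_weight half_power_le0 ?mul0r// subr_le0.
  rewrite mul0e; apply: integral0_eq => t _; apply: integral0_eq => r _.
  have [r0|r0] := leP r 0%R; first by rewrite half_power_le0// mul0r.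
  rewrite (@half_power_le0 _ n (1 - u - _))%R ?mul0r ?mulr0//.
  have : (0 <= (1 - cos t) * r)%R by rewrite mulr_ge0 ?subr_ge0 ?cos_le1// ltW.
  by lra.
have [u2|u2] := leP u (-1)%R.
  rewrite [X in X * _](_ : _ = 0); last first.
    by rewrite /gegenbauer_weight (@half_power_le0 _ _ (1 + u))%R ?mulr0//; lra.
  rewrite mul0e; apply: integral0_eq => t _; apply: integral0_eq => r _.
  have [r0|r0] := leP r 0%R; first by rewrite half_power_le0// mul0r.
  rewrite (@half_power_le0 _ n (1 + u - _))%R ?mulr0//.
  have : (0 <= (1 + cos t) * r)%R.
    by rewrite mulr_ge0// ?(ltW r0)//; have := cos_geN1 t; lra.
  by lra.
rewrite !averaged_weight_cauchy subr0 addr0.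
set A := (1 - u)%R; set B := (1 + u)%R.
have A0 : (0 < A)%R by rewrite subr_gt0.
have B0 : (0 < B)%R by rewrite /B; lra.
pose K x := \int[mu]_r (integrand n 1 1 1 (x ^+ 2) r)%:E.
have mK : measurable_fun setT K.
  apply: (@measurable_integral_in _ _ _ R (measurableTypeR R) mu setT
    (fun z => (integrand n 1 1 1 (z.1 ^+ 2) z.2)%:E)) => //.
  - by rewrite /integrand; measurable_real.
  - by move=> z; rewrite lee_fin integrand_ge0.
have K0 x : 0 <= K x.
  by apply: integral_ge0 => r _; rewrite lee_fin integrand_ge0.
pose l := Num.sqrt (A / B).
have AB0 : (0 < A / B)%R by rewrite divr_gt0.
have l0 : (0 < l)%R by rewrite sqrtr_gt0.
transitivity (\int[mu]_x ((A * half_power n A * half_power n B)%:E * K (l * x + 0)%R)).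
  apply: eq_integral => x _.
  have := @ge0_integral_affine _ A 0%R (fun r => (integrand n A B 1 (x ^+ 2) r)%:E).
  move=> /(_ (lt0r_neq0 A0)).
  rewrite gtr0_norm// => /(_ _ _)/esym; rewrite -/mu.
  have m1 : measurable_fun setT (fun r => (integrand n A B 1 (x ^+ 2) r)%:E).
    by rewrite /integrand; measurable_real.
  have m2 r : 0 <= (integrand n A B 1 (x ^+ 2) r)%:E.
    by rewrite lee_fin integrand_ge0.
  move=> /(_ m1 m2).
  move=> /(congr1 (mule A%:E)); rewrite muleA -EFinM divff ?gt_eqF// mul1e => ->.
  rewrite (_ : \int[mu]_r _ = (half_power n A * half_power n B)%:E * K (l * x + 0)%R).
    by rewrite muleA -EFinM mulrA.
  rewrite /K -ge0_integralZl//.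
  - apply: eq_integral => r _; rewrite /integrand !addr0 half_powerM//.
    rewrite (@half_power_gt0E _ 0%N A)// expr0 mul1r mul1r -EFinM.
    rewrite (_ : A - A * r = A * (1 - r))%R; last by ring.
    rewrite (_ : B - _ = B * (1 - (l * x) ^+ 2 * r))%R; last first.
      by rewrite exprMn sqr_sqrtr ?ltW//; field; rewrite gt_eqF.
    by rewrite !half_powerM// mul1r; congr EFin; ring.
  - by rewrite /integrand; measurable_real.
  - by move=> r _; rewrite lee_fin integrand_ge0.
  - by rewrite lee_fin mulr_ge0// half_power_ge0.
have mKl : measurable_fun setT (fun x => K (l * x + 0)%R).
  by apply: measurableT_comp mK _; measurable_real.
have c0 : 0 <= (A * half_power n A * half_power n B)%:E.
  by rewrite lee_fin !mulr_ge0 ?half_power_ge0// ltW.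
transitivity ((A * half_power n A * half_power n B)%:E *
    \int[mu]_x K (l * x + 0)%R); first by apply: ge0_integralZl.
rewrite (ge0_integral_affine _ (lt0r_neq0 l0) mK)// muleA -EFinM gtr0_norm//; congr (_%:E * _).
rewrite /gegenbauer_weight !half_power_gt0E// !exprS /l.
rewrite sqrtrM ?(ltW A0)// sqrtrV ?ltW// -{1}(sqr_sqrtr (ltW A0)).
have sA : (Num.sqrt A != 0)%R by rewrite gt_eqF// sqrtr_gt0.
have sB : (Num.sqrt B != 0)%R by rewrite gt_eqF// sqrtr_gt0.
by field; rewrite sA sB.
Qed.

End sphere_integral.

Section sphere_integral_mass.
Local Open Scope ereal_scope.
Context {R : realType}.
Let mu := @lebesgue_measure R.
Implicit Types (a b u c r : R) (n : nat).

Definition weight_mass n : \bar R := \int[mu]_u (gegenbauer_weight n u)%:E.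

Lemma integral_power_simplex n :
  \int[mu]_r (half_power 0 r * truncated_power n.+1 (1 - r))%:E =
  (n.+2%:R^-1)%:E.
Proof.
transitivity (\int[mu]_(r in `[0%R, 1%R]) ((1 - r) ^+ n.+1)%:E).
  rewrite -integral_itv_obnd_cbnd; last first.
    apply/measurable_EFinP/measurable_funTS; apply: measurable_funX.
    exact: measurable_funB.
  rewrite [RHS]integral_mkcond; apply: eq_integral => r _; rewrite patchE.
  rewrite mem_setE in_itv/= /truncated_power subr_gt0.
  have [r0|r0] /= := ltP 0%R r; last by rewrite half_power_le0// mul0r.
  rewrite half_power_gt0E// expr0 mul1r.
  have [r1|r1] := ltP r 1%R; first by rewrite ltW.
  rewrite le_eqVlt ltNge r1 orbF; case: eqP => // ->.
  by rewrite subrr expr0n.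
rewrite -[RHS](congr1 EFin (@Rintegral_onemXn R n.+1)) /Rintegral fineK//.
apply: integrable_fin_num => //; apply: continuous_compact_integrable.
  exact: segment_compact.
by apply: continuous_subspaceT => r; exact: continuous_onemXn.
Qed.

(** Centring [u] at [c r] makes both bases multiples of [1 - r]. *)
Lemma integral_translated_weight n r c :
  \int[mu]_u (half_power 0 r * (half_power n (1 - u - (1 - c) * r)
                       * half_power n (1 + u - (1 + c) * r)))%:E =
  (half_power 0 r * truncated_power n.+1 (1 - r))%:E * weight_mass n.
Proof.
set g := (fun u => (_ * _)%:E).
have g0 u : 0 <= g u by rewrite lee_fin !mulr_ge0// half_power_ge0.
have mg : measurable_fun setT g by rewrite /g; measurable_real.
have [r0|r0] := leP r 0%R.
  rewrite half_power_le0// mul0r mul0e integral0_eq// => u _.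
  by rewrite /g half_power_le0// mul0r.
have [r1|r1] := leP 1%R r.
  rewrite [truncated_power _ _](_ : _ = 0%R) ?mulr0 ?mul0e; last first.
    by rewrite /truncated_power subr_gt0 ltNge r1.
  by rewrite integral0_eq// => u _; rewrite /g half_power_slice_out// mulr0.
have s0 : (0 < 1 - r)%R by rewrite subr_gt0.
have := ge0_integral_affine (c * r)%R (lt0r_neq0 s0) mg g0.
rewrite gtr0_norm// => /(congr1 (mule (1 - r)%:E)).
rewrite muleA -EFinM divff ?gt_eqF// mul1e => <-.
have gE u : g ((1 - r) * u + c * r)%R =
    (half_power 0 r * half_power n (1 - r) * half_power n (1 - r)
     * gegenbauer_weight n u)%:E.
  rewrite /g /gegenbauer_weight.
  rewrite [X in half_power n X](_ : _ = (1 - r) * (1 - u))%R; last by ring.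
  rewrite [X in (_ * half_power n X)%R](_ : _ = (1 - r) * (1 + u))%R; last by ring.
  by rewrite !half_powerM//; congr EFin; ring.
under eq_integral do rewrite gE EFinM.
rewrite (_ : \int[mu]_u _ =
  (half_power 0 r * half_power n (1 - r) * half_power n (1 - r))%:E
  * weight_mass n).
  rewrite muleA -EFinM -[truncated_power _ _]half_power_sqr.
  rewrite !half_power_gt0E// !exprS -{1}(sqr_sqrtr (ltW s0)).
  by congr (_%:E * _); ring.
apply: ge0_integralZl => //.
- by apply/measurable_EFinP; exact: measurable_gegenbauer_weight.
- by move=> u _; rewrite lee_fin gegenbauer_weight_ge0.
- by rewrite lee_fin !mulr_ge0// half_power_ge0.
Qed.

Lemma integral_averaged_weight n :
  \int[mu]_u averaged_weight n u = (2 * pi / n.+2%:R)%:E * weight_mass n.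
Proof.
pose f (z : R * R * R) : \bar R := (half_power 0 z.2 *
  (half_power n (1 - z.1.1 - (1 - cos z.1.2) * z.2)
   * half_power n (1 + z.1.1 - (1 + cos z.1.2) * z.2)))%:E.
have f0 z : 0 <= f z by rewrite lee_fin !mulr_ge0// half_power_ge0.
have m11 : measurable_fun setT (fun z : R * R * R => z.1.1).
  exact: measurableT_comp measurable_fst measurable_fst.
have mc : measurable_fun setT (fun z : R * R * R => cos z.1.2).
  apply: measurableT_comp (continuous_measurable_fun (@continuous_cos R)) _.
  exact: measurableT_comp measurable_snd measurable_fst.
have mf : measurable_fun setT f by rewrite /f; measurable_real.
have mI : measurable_fun setT (fun z : R * R => \int[mu]_r f (z, r)).
  exact: (@measurable_integral_in _ _ _ _ (measurableTypeR R) mu setT f).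
have I0 (z : R * R) : 0 <= \int[mu]_r f (z, r) by apply: integral_ge0.
apply: (eq_trans (@tonelli_in _ _ _ (measurableTypeR R) (measurableTypeR R) mu mu setT
  `[0%R, (2 * pi)%R[%classic (fun z => \int[mu]_r f (z, r)) _ _ mI I0)) => //.
transitivity (\int[mu]_(t in `[0%R, (2 * pi)%R[)
    ((n.+2%:R^-1)%:E * weight_mass n)).
  apply: eq_integral => t _.
  pose h (z : R * R) := f (z.1, t, z.2).
  have mh : measurable_fun setT h.
    apply: measurableT_comp mf _; apply: measurable_fun_pair; last exact: measurable_snd.
    by apply: measurable_fun_pair => //; exact: measurable_fst.
  transitivity (\int[mu]_r \int[mu]_u h (u, r)).
    exact: (@fubini_tonelli _ _ (measurableTypeR R) (measurableTypeR R) _ mu mu h mh (fun z => f0 _)).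
  rewrite -integral_power_simplex.
  transitivity (\int[mu]_r ((half_power 0 r * truncated_power n.+1 (1 - r))%:E
      * weight_mass n)).
    by apply: eq_integral => r _; rewrite -(integral_translated_weight n r (cos t)).
  apply: ge0_integralZr => //.
  - apply/measurable_EFinP; apply: measurable_funM.
      exact: (@measurable_half_power _ _ _ id).
    apply: measurableT_comp (measurable_truncated_power n.+1) _.
    by measurable_real.
  - move=> r _; rewrite lee_fin mulr_ge0 ?half_power_ge0// /truncated_power.
    by case: ifP => // /ltW ?; rewrite exprn_ge0.
  - by apply: integral_ge0 => u _; rewrite lee_fin gegenbauer_weight_ge0.
rewrite -[LHS]/(\int[mu]_(t in `[0%R, (2 * pi)%R[) (cst ((n.+2%:R^-1)%:E * weight_mass n) t)).
rewrite integral_cst//= lebesgue_measure_itv/= lte_fin mulr_gt0 ?pi_gt0//.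
by rewrite sube0 muleAC -EFinM mulrC.
Qed.

End sphere_integral_mass.

(** * The total mass of the weights *)

Section weight_mass_gamma.
Local Open Scope ereal_scope.
Context {R : realType}.
Let mu := @lebesgue_measure R.
Implicit Types (u v : R) (n : nat).

Lemma gegenbauer_weightE n u : gegenbauer_weight n u = half_power n (1 - u ^+ 2).
Proof.
rewrite /gegenbauer_weight; have [u1|u1] := ltP `|u|%R 1%R.
  move: u1; rewrite ltr_norml => /andP[u1 u2].
  rewrite -half_powerM ?subr_gt0//; congr half_power; ring.
have u2 : (1 - u ^+ 2 <= 0)%R by rewrite -(real_normK (num_real u)); nra.
rewrite (half_power_le0 _ u2); move: u1; rewrite ler_normr => /orP[]u1.
  by rewrite half_power_le0 ?mul0r// subr_le0.
by rewrite (@half_power_le0 _ _ (1 + u))%R ?mulr0//; lra.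
Qed.

Lemma weight_mass_lty n : weight_mass n < +oo :> \bar R.
Proof.
apply: (@le_lt_trans _ _ (\int[mu]_u (\1_(`[(-1)%R, 1%R]%classic : set R) u)%:E)).
  apply: ge0_le_integral => //.
  - by move=> u _; rewrite lee_fin gegenbauer_weight_ge0.
  - by apply/measurable_EFinP; exact: measurable_gegenbauer_weight.
  - by apply/measurable_EFinP; exact: measurable_indic.
  move=> u _; rewrite lee_fin gegenbauer_weightE indicE mem_setE in_itv/=.
  have [u1|u1] := leP (1 - u ^+ 2)%R 0%R; first by rewrite half_power_le0.
  have u2 : (-1 <= u <= 1)%R.
    by rewrite -ler_norml -(@expr_le1 _ 2%N)// real_normK ?num_real//; lra.
  rewrite u2 half_power_gt0E// exprn_ile1// ?sqrtr_ge0//.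
  have := @ler_wsqrtr R (1 - u ^+ 2)%R 1%R; rewrite sqrtr1; apply.
  by have := sqr_ge0 u; lra.
rewrite integral_indic// setIT /= lebesgue_measure_itv/= lte_fin.
by case: ifP => _; rewrite ?ltry// -EFinB ltry.
Qed.

Lemma weight_mass_gt0 n : 0 < weight_mass n :> \bar R.
Proof.
apply: (@lt_le_trans _ _ (\int[mu]_(u in `[0%R, 2^-1%R])
   (half_power n (3 / 4))%:E)).
  rewrite -[ltRHS]/(\int[mu]_(u in `[0%R, 2^-1%R]) (cst (half_power n (3 / 4))%:E u)).
  rewrite integral_cst//= lebesgue_measure_itv/= lte_fin invr_gt0 ltr0n /=.
  rewrite sube0 -EFinM lte_fin mulr_gt0 ?invr_gt0 ?ltr0n//.
  by rewrite half_power_gt0E ?exprn_gt0 ?sqrtr_gt0//; lra.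
rewrite /weight_mass.
apply: (@le_trans _ _ (\int[mu]_(u in `[0%R, 2^-1%R]) (gegenbauer_weight n u)%:E)).
  apply: ge0_le_integral => //.
  - by move=> u _; rewrite lee_fin half_power_ge0.
  - by apply/measurable_EFinP/measurable_funTS; exact: measurable_gegenbauer_weight.
  move=> u /=; rewrite in_itv/= => /andP[u0 u1].
  rewrite lee_fin gegenbauer_weightE.
  have u2 : (3 / 4 <= 1 - u ^+ 2)%R by nra.
  have q0 : (0 < 3 / 4 :> R)%R by lra.
  rewrite !half_power_gt0E ?(lt_le_trans q0)//.
  by rewrite lerXn2r ?nnegrE ?sqrtr_ge0// ler_wsqrtr.
apply: ge0_subset_integral => //.
- by apply/measurable_EFinP; exact: measurable_gegenbauer_weight.
- by move=> u _; rewrite lee_fin gegenbauer_weight_ge0.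
Qed.

(** [Gamma (n / 2 + 1)]; see [Gamma_half]. An extended real, so that finiteness
    can be deduced from [weight_mass_gamma]. *)
Definition gamma_half n : \bar R :=
  \int[mu]_v (half_power n v * expR (- v))%:E.

Lemma gamma_halfE n : gamma_half n = \int[mu]_(t in `]0%R, +oo[)
  (t `^ (n.+2%:R / 2 - 1) * expR (- t))%:E.
Proof.
rewrite [RHS]integral_mkcond; apply: eq_integral => t _; rewrite patchE.
rewrite mem_setE in_itv/= andbT; case: ifPn => [t0|]; last first.
  by rewrite -leNgt => t0; rewrite half_power_le0// mul0r.
rewrite half_power_gt0E// -powR12_sqrt ?ltW// -powR_mulrn ?powR_ge0// -powRrM.
by congr (_ `^ _ * _)%:E; rewrite -[n.+2]addn2 natrD; field.
Qed.

Lemma gamma_half0 : gamma_half 0 = 1.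
Proof.
rewrite /gamma_half.
rewrite -(@integral_exponential_pdf R 1)//.
transitivity (\int[mu]_(t in `]0%R, +oo[) (exponential_pdf 1 t)%:E).
  rewrite [RHS]integral_mkcond; apply: eq_integral => t _; rewrite patchE.
  rewrite mem_setE in_itv/= andbT; have [t0|t0] := ltP 0%R t.
    rewrite half_power_gt0E// expr0 mul1r exponential_pdfE ?ltW//.
    by rewrite mul1r mulN1r.
  by rewrite half_power_le0// mul0r.
rewrite integral_itv_obnd_cbnd; last first.
  by apply/measurable_EFinP/measurable_funTS; exact: measurable_exponential_pdf.
rewrite integral_mkcond; apply: eq_integral => t _; rewrite patchE.
rewrite mem_setE in_itv/= andbT; case: ifPn => //.
by rewrite -ltNge => t0; rewrite lt0_exponential_pdf.
Qed.

(** Integrate [(v - u^2)_+^(n/2) exp(-v)] over the plane. Over [u] first, scaling by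
    [sqrt v] gives the mass of the weight times [v^((n+1)/2)]; over [v] first,
    translating by [u^2] gives a Gaussian in [u]. *)
Lemma weight_mass_gamma n :
  weight_mass n * gamma_half n.+1 = (Num.sqrt pi)%:E * gamma_half n.
Proof.
pose f (z : R * R) : \bar R := (half_power n (z.1 - z.2 ^+ 2) * expR (- z.1))%:E.
have mexp d (X : measurableType d) (g : X -> R) : measurable_fun setT g ->
    measurable_fun setT (fun x => expR (g x)).
  by move=> mg; apply: measurableT_comp mg => //; exact: measurable_expR.
have mf : measurable_fun setT f.
  apply/measurable_EFinP/measurable_funM; first by measurable_real.
  by apply: mexp; apply: measurable_funN; exact: measurable_fst.
have f0 z : 0 <= f z by rewrite lee_fin mulr_ge0 ?half_power_ge0// expR_ge0.
have mg m : measurable_fun setT (fun v : R => (half_power m v * expR (- v))%:E).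
  apply/measurable_EFinP/measurable_funM; first by measurable_real.
  by apply: mexp; exact: measurable_funN.
have g0 m (v : R) : 0 <= (half_power m v * expR (- v))%:E.
  by rewrite lee_fin mulr_ge0 ?half_power_ge0// expR_ge0.
have := @fubini_tonelli _ _ (measurableTypeR R) (measurableTypeR R) _ mu mu f mf f0.
rewrite [LHS](_ : _ = weight_mass n * gamma_half n.+1); last first.
  transitivity (\int[mu]_v (weight_mass n * (half_power n.+1 v * expR (- v))%:E)).
    apply: eq_integral => v _; rewrite /f /=.
    have [v0|v0] := leP v 0%R.
      rewrite half_power_le0// mul0r mule0 integral0_eq// => u _.
      by rewrite half_power_le0 ?mul0r//; have := sqr_ge0 u; lra.
    have s0 : (0 < Num.sqrt v)%R by rewrite sqrtr_gt0.
    pose h u := (half_power n (v - u ^+ 2) * expR (- v))%:E.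
    have mh : measurable_fun setT h.
      by apply/measurable_EFinP/measurable_funM; measurable_real.
    have h0 u : 0 <= h u by rewrite lee_fin mulr_ge0 ?half_power_ge0// expR_ge0.
    have := ge0_integral_affine 0%R (lt0r_neq0 s0) mh h0.
    rewrite gtr0_norm// => /(congr1 (mule (Num.sqrt v)%:E)).
    rewrite muleA -EFinM divff ?gt_eqF// mul1e -/mu => <-.
    rewrite [X in _ * X](_ : _ = (half_power n v * expR (- v))%:E * weight_mass n).
      by rewrite muleA -EFinM muleC !half_power_gt0E// exprS mulrA.
    transitivity (\int[mu]_u ((half_power n v * expR (- v))%:E
        * (gegenbauer_weight n u)%:E)).
      apply: eq_integral => u _; rewrite /h addr0 exprMn sqr_sqrtr ?ltW//.
      rewrite (_ : v - v * _ = v * (1 - u ^+ 2))%R; last by ring.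
      by rewrite half_powerM// gegenbauer_weightE -EFinM; congr EFin; ring.
    apply: ge0_integralZl => //.
    - by apply/measurable_EFinP; exact: measurable_gegenbauer_weight.
    - by move=> u _; rewrite lee_fin gegenbauer_weight_ge0.
  apply: ge0_integralZl => //; first exact: mg.
  by apply: integral_ge0 => u _; rewrite lee_fin gegenbauer_weight_ge0.
move=> ->.
transitivity (\int[mu]_u ((gauss_fun u)%:E * gamma_half n)).
  apply: eq_integral => u _.
  have mfu : measurable_fun setT (fun v => f (v, u)).
    apply: measurableT_comp mf _; exact: measurable_fun_pair.
  have := ge0_integral_affine (u ^+ 2)%R (oner_neq0 R) mfu (fun v => f0 (v, u)).
  rewrite normr1 invr1 mul1e -/mu => <-.
  transitivity (\int[mu]_v ((gauss_fun u)%:E * (half_power n v * expR (- v))%:E)).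
    apply: eq_integral => v _; rewrite /f /= mul1r addrK opprD expRD.
    by rewrite -EFinM /gauss_fun; congr EFin; ring.
  by apply: ge0_integralZl => //; [exact: mg|rewrite lee_fin gauss_fun_ge0].
rewrite -integralT_gauss; apply: ge0_integralZr => //.
- by apply/measurable_EFinP; exact: measurable_gauss_fun.
- by move=> u _; rewrite lee_fin gauss_fun_ge0.
- by apply: integral_ge0 => v _; exact: g0.
Qed.

(** [weight_mass_gamma] propagates finiteness and positivity from
    [Gamma 1 = 1], since the masses are themselves finite and positive. *)
Lemma gamma_half_fin_gt0 n : 0 < gamma_half n < +oo.
Proof.
elim: n => [|n /andP[IH0 IHoo]]; first by rewrite gamma_half0 lte_fin ltr01 ltry.
have W0 := weight_mass_gt0 n; have Woo := weight_mass_lty n.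
have := weight_mass_gamma n.
have s0 : (0 < Num.sqrt pi :> R)%R by rewrite sqrtr_gt0 pi_gt0.
have G0 : 0 <= gamma_half n.+1.
  by apply: integral_ge0 => v _; rewrite lee_fin mulr_ge0 ?half_power_ge0// expR_ge0.
have : gamma_half n \is a fin_num by rewrite ge0_fin_numE// ltW.
have : (weight_mass n : \bar R) \is a fin_num by rewrite ge0_fin_numE// ltW.
move=> /fineK WE /fineK GE.
move: IH0 W0; rewrite -WE -GE !lte_fin => IH0 W0.
case: (gamma_half n.+1) G0 => [g| |] //=.
  rewrite -!EFinM lee_fin => g0 [] E; rewrite lte_fin ltry andbT lt_neqAle g0 andbT.
  apply/eqP => g0'; move: E; rewrite -g0' mulr0 => /esym/eqP.
  by rewrite mulf_eq0 !gt_eqF.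
by rewrite gt0_muley ?lte_fin// -EFinM.
Qed.

Lemma Gamma_half n : (Gamma (n.+2%:R / 2))%:E = gamma_half n :> \bar R.
Proof.
rewrite gamma_halfE /Gamma /Rintegral fineK// -gamma_halfE ge0_fin_numE.
  by case/andP: (gamma_half_fin_gt0 n).
by apply: ltW; case/andP: (gamma_half_fin_gt0 n).
Qed.

Lemma weight_massE n : weight_mass n =
  (Num.sqrt pi * Gamma (n.+2%:R / 2) / Gamma (n.+3%:R / 2))%:E :> \bar R.
Proof.
have := weight_mass_gamma n; rewrite -!Gamma_half.
have /andP[+ _] := gamma_half_fin_gt0 n.+1; rewrite -Gamma_half lte_fin => G0.
have : (weight_mass n : \bar R) \is a fin_num.
  by rewrite ge0_fin_numE ?weight_mass_lty// ltW// weight_mass_gt0.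
move=> /fineK <-; rewrite -!EFinM => -[E]; congr EFin.
by rewrite -E mulfK// gt_eqF.
Qed.

End weight_mass_gamma.

(** * Divided differences *)

Require Import Defs.
From mathcomp Require Import all_boot all_order all_algebra.
From mathcomp Require Import all_classical all_reals all_analysis.
From mathcomp Require Import ring lra.

Import Order.TTheory GRing.Theory Num.Theory.
Import numFieldNormedType.Exports.

Set Implicit Arguments.
Unset Strict Implicit.
Unset Printing Implicit Defensive.

Local Open Scope classical_set_scope.
Local Open Scope ring_scope.

Section divided_difference_theory.
Variable K : fieldType.
Implicit Types (f g : K -> K) (x : nat -> K) (a c : K).

Definition distinct_knots m x :=
  forall i j, (i <= m)%N -> (j <= m)%N -> i != j -> x i != x j.

Lemma distinct_knotsW m x : distinct_knots m.+1 x -> distinct_knots m x.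
Proof. by move=> xm i j im jm; apply: xm; exact: leqW. Qed.

Lemma distinct_knotsS m x :
  distinct_knots m.+1 x -> distinct_knots m (fun i => x i.+1).
Proof. by move=> xm i j im jm ij; exact: xm. Qed.

Lemma divided_differenceS f m x : divided_difference f m.+1 x =
  (divided_difference f m x - divided_difference f m (fun i => x i.+1))
    / (x 0%N - x m.+1).
Proof. by []. Qed.

Lemma eq_divided_difference f g m x :
  (forall i, (i <= m)%N -> f (x i) = g (x i)) ->
  divided_difference f m x = divided_difference g m x.
Proof.
elim: m x => [|m IHm] x fg /=; first exact: fg.
by rewrite !IHm// => i im; apply: fg; rewrite // ltnW.
Qed.

Lemma divided_difference_const c m x :
  divided_difference (fun=> c) m.+1 x = 0.
Proof.
elim: m x => [|m IHm] x; first by rewrite /= subrr mul0r.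
by rewrite divided_differenceS !IHm subrr mul0r.
Qed.

Lemma divided_differenceD f g m x :
  divided_difference (fun y => f y + g y) m x =
  divided_difference f m x + divided_difference g m x.
Proof. by elim: m x => [//|m IHm] x /=; rewrite !IHm; ring. Qed.

Lemma divided_differenceZ c f m x :
  divided_difference (fun y => c * f y) m x = c * divided_difference f m x.
Proof. by elim: m x => [//|m IHm] x /=; rewrite !IHm; ring. Qed.

(** Leibniz' rule for a product in which one factor is affine. *)
Lemma divided_difference_linear_factor a g m x : distinct_knots m.+1 x ->
  divided_difference (fun y => (y - a) * g y) m.+1 x =
  (x m.+1 - a) * divided_difference g m.+1 x + divided_difference g m x.
Proof.
elim: m x => [|m IHm] x dx.
  by rewrite /=; field; rewrite subr_eq0 dx.
have x0m : x 0%N - x m.+1 != 0 by rewrite subr_eq0 dx.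
have x0m2 : x 0%N - x m.+2 != 0 by rewrite subr_eq0 dx.
rewrite divided_differenceS IHm ?IHm; [|exact: distinct_knotsS|exact: distinct_knotsW].
have -> : divided_difference g m x = divided_difference g m (fun i => x i.+1)
    + (x 0%N - x m.+1) * divided_difference g m.+1 x.
  by rewrite divided_differenceS; field.
by rewrite (divided_differenceS g m.+1); field.
Qed.

(** Off [x 0], [f] is a constant plus the affine function [y - x 0] times its slope
    from [x 0]; the affine Leibniz rule turns this into an induction on [m]. *)
Lemma divided_difference_slope f m x : distinct_knots m.+1 x ->
  divided_difference f m.+1 x =
  divided_difference (fun y => (f y - f (x 0%N)) / (y - x 0%N)) m
    (fun i => x i.+1).
Proof.
set a := x 0%N; set g := fun y => _.
elim: m x @a @g => [|m IHm] x a g dx.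
  have x01 : x 0%N - x 1%N != 0 by rewrite subr_eq0 dx.
  have x10 : x 1%N - x 0%N != 0 by rewrite subr_eq0 dx.
  by rewrite /= /g /a; field; rewrite x01 x10.
have x0m2 : x 0%N - x m.+2 != 0 by rewrite subr_eq0 dx.
rewrite divided_differenceS.
rewrite (IHm _ (distinct_knotsW dx)) -/a -/g.
rewrite (@eq_divided_difference f (fun y => (y - a) * g y + f a) m.+1); last first.
  move=> i im; rewrite /g mulrC divfK ?subrK// subr_eq0.
  exact: dx.
rewrite divided_differenceD divided_difference_const addr0.
rewrite divided_difference_linear_factor; last exact: distinct_knotsS.
by rewrite /a; field.
Qed.

End divided_difference_theory.

(** * Peeling one knot off a B-spline *)

Section truncated_power_integral.
Local Open Scope ereal_scope.
Context {R : realType}.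
Let mu := @lebesgue_measure R.
Implicit Types (a b p q : R) (k : nat).

Lemma truncated_power_max k (x : R) : truncated_power k.+1 x = (Num.max x 0 ^+ k.+1)%R.
Proof.
by rewrite /truncated_power; have [x0|x0] := ltP 0%R x; rewrite ?expr0n.
Qed.

Lemma truncated_power_ge0 k (x : R) : (0 <= truncated_power k x)%R.
Proof. by rewrite /truncated_power; case: ifP => // /ltW x0; rewrite exprn_ge0. Qed.

Lemma integral_truncated_power_itv k a b : (a < b)%R ->
  \int[mu]_(z in `]a, b[) (truncated_power k z)%:E =
  ((truncated_power k.+1 b - truncated_power k.+1 a) / k.+1%:R)%:E.
Proof.
move=> ab; rewrite !truncated_power_max.
have mX (D : set R) : measurable_fun D (EFin \o (fun z : R => z ^+ k)%R).
  by apply/measurable_EFinP/measurable_funTS; exact: measurable_funX.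
transitivity (\int[mu]_(z in `](Num.max a 0)%R, (Num.max b 0)%R[) (z ^+ k)%:E).
  rewrite integral_mkcond [RHS]integral_mkcond; apply: eq_integral => z _.
  rewrite !patchE !mem_setE !in_itv/= /truncated_power gt_max lt_max.
  have [z0|z0] := ltP 0%R z; first by rewrite andbT (lt_gtF z0) orbF.
  by rewrite andbF; case: ifP.
have : (Num.max a 0 <= Num.max b 0)%R by rewrite le_max2// ltW.
set a' := Num.max a 0%R; set b' := Num.max b 0%R.
rewrite le_eqVlt => /predU1P[<-|ab'].
  by rewrite subrr mul0r set_itvoo0 integral_set0.
rewrite (_ : \int[mu]_(z in _) _ = \int[mu]_(z in `[a', b']) (z ^+ k)%:E); last first.
  by rewrite integral_itv_bndo_bndc ?integral_itv_obnd_cbnd.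
rewrite (@continuous_FTC2 _ _ (fun z => k.+1%:R^-1 * z ^+ k.+1)%R)//.
- by rewrite -EFinB; congr EFin; ring.
- by apply: continuous_subspaceT => z; exact: exprn_continuous.
- have c z : {for z, continuous (fun z : R => k.+1%:R^-1 * z ^+ k.+1)%R}.
    by apply: cvgM; [exact: cvg_cst|exact: exprn_continuous].
  split.
  + move=> z _; apply: derivableM; first exact: derivable_cst.
    exact: exprn_derivable.
  + by apply: cvg_at_right_filter; exact: c.
  + by apply: cvg_at_left_filter; exact: c.
- move=> z _; rewrite derive1Ml; last exact: exprn_derivable.
  by rewrite exp_derive1/= mulrA mulVf ?mul1r// pnatr_eq0.
Qed.

(** The slope of [z |-> z_+^(k+1)] between [p] and [q] is the mean of its
    derivative over the segment. *)
Lemma integral_truncated_power_segment k p q : p != q ->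
  \int[mu]_(r in `]0%R, 1%R[) (truncated_power k (p + (q - p) * r))%:E =
  ((truncated_power k.+1 q - truncated_power k.+1 p) / (k.+1%:R * (q - p)))%:E.
Proof.
move=> pq; have qp0 : (q - p != 0)%R by rewrite subr_eq0 eq_sym.
have n0 : (k.+1%:R != 0 :> R)%R by rewrite pnatr_eq0.
have sub (a b : R) : (a < b)%R ->
    (forall r : R, (0 < r < 1)%R = (a < (q - p) * r + p < b)%R) ->
    \int[mu]_(r in `]0%R, 1%R[) (truncated_power k (p + (q - p) * r))%:E =
    (`|q - p|^-1 * ((truncated_power k.+1 b - truncated_power k.+1 a) / k.+1%:R))%:E.
  move=> ab rE; rewrite EFinM -integral_truncated_power_itv//.
  rewrite integral_mkcond [X in _ * X]integral_mkcond -(@ge0_integral_affine _ _ p)//.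
  - apply: eq_integral => r _; rewrite !patchE !mem_setE !in_itv/= rE.
    by rewrite (addrC p).
  - apply/(measurable_restrictT _ (measurable_itv _))/measurable_funTS.
    by apply/measurable_EFinP; exact: measurable_truncated_power.
  - by move=> z; rewrite patchE; case: ifP => // _; rewrite lee_fin truncated_power_ge0.
have [pq'|qp'|pqE] := ltgtP p q; last by rewrite pqE eqxx in pq.
  rewrite (sub p q)//.
    by rewrite gtr0_norm ?subr_gt0//; congr EFin; move: (k.+1%:R)%R n0 => n n0; field; rewrite n0 qp0.
  move=> r; rewrite ltrDr -subr_gt0 pmulr_rgt0 ?subr_gt0//.
  by congr (_ && _); rewrite -ltrBrDr gtr_pMr ?subr_gt0.
rewrite (sub q p)//.
  by rewrite ltr0_norm ?subr_lt0//; congr EFin; move: (k.+1%:R)%R n0 => n n0; field; rewrite n0 qp0.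
have d0 : (q - p < 0)%R by rewrite subr_lt0.
move=> r; rewrite andbC; congr (_ && _).
  by rewrite -ltrBlDr ltr_nMr.
by rewrite gtrDr nmulr_rlt0.
Qed.

End truncated_power_integral.

Section bspline_recursion.
Context {R : realType}.
Let mu := @lebesgue_measure R.
Let I01 := (`]0, 1[%classic : set R).

Lemma Rintegral_divided_difference (h : R -> R -> R) m x :
  (forall y, mu.-integrable I01 (EFin \o h^~ y)) ->
  mu.-integrable I01 (EFin \o (fun r => divided_difference (h r) m x)) /\
  \int[mu]_(r in I01) divided_difference (h r) m x =
  divided_difference (fun y => \int[mu]_(r in I01) h r y) m x.
Proof.
move=> ih; have mI : @measurable _ (measurableTypeR R) I01 by exact: measurable_itv.
elim: m x => [|m IHm] x; first by split => //; exact: ih.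
have [i1 e1] := IHm x; have [i2 e2] := IHm (fun i => x i.+1).
have iB : mu.-integrable I01 (EFin \o (fun r => divided_difference (h r) m x -
    divided_difference (h r) m (fun i => x i.+1))).
  by apply: (eq_integrable mI _ _ _ (integrableB mI i1 i2)).
split; first by apply: (eq_integrable mI _ _ _ (integrableZr mI (x 0%N - x m.+1)^-1 iB)).
rewrite divided_differenceS -e1 -e2 -RintegralB// -RintegralZr//.
Qed.

(** The contribution of the points at which the knot [x 0] has weight [r]. *)
Definition bspline_slice k (x : nat -> R) u r :=
  (1 - r) ^+ k * bspline k.+1 (fun i => x i.+1) ((u - r * x 0%N) / (1 - r)).

(** The slope from [x 0] of [y |-> (y - u)_+^(k+1)] is the mean of [(z - u)_+^k] over
    [z = (1 - r) y + r (x 0)], and [z - u] is [1 - r] times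
    [y - (u - r (x 0)) / (1 - r)]. *)
Lemma bspline_recursion k x u : distinct_knots k.+2 x ->
  mu.-integrable I01 (EFin \o bspline_slice k x u) /\
  bspline k.+2 x u = \int[mu]_(r in I01) bspline_slice k x u r.
Proof.
move=> dx; have mI : @measurable _ (measurableTypeR R) I01 by exact: measurable_itv.
set a := x 0%N.
pose h r y := truncated_power k (y - u + (a - u - (y - u)) * r) / k`!%:R.
have k0 : k`!%:R != 0 :> R by rewrite pnatr_eq0 -lt0n fact_gt0.
have n0 : k.+1%:R != 0 :> R by rewrite pnatr_eq0.
have f0 y : mu.-integrable I01 (EFin \o (fun r =>
    truncated_power k (y - u + (a - u - (y - u)) * r))).
  apply: measurable_bounded_integrable => //.
  - by rewrite /= lebesgue_measure_itv/= lte_fin ltr01 -EFinB ltry.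
  - apply: measurable_funTS.
    apply: measurableT_comp (measurable_truncated_power k) _.
    by apply: measurable_funD => //; exact: measurable_funM.
  exists ((`|y - u| + `|a - u - (y - u)|) ^+ k); split; first exact: num_real.
  move=> N MN r; rewrite /I01 /= in_itv/= => /andP[r0 r1].
  apply: le_trans (ltW MN).
  rewrite ger0_norm ?truncated_power_ge0//.
  rewrite /truncated_power; case: ifP => [z0|_]; last by rewrite exprn_ge0.
  rewrite lerXn2r ?nnegrE ?(ltW z0) ?addr_ge0//.
  apply: le_trans (ler_norm _) _; apply: le_trans (ler_normD _ _) _.
  by rewrite lerD2l normrM ler_piMr// gtr0_norm// ltW.
have ih y : mu.-integrable I01 (EFin \o h^~ y) 
  by apply: (eq_integrable mI _ _ _ (integrableZr mI (k`!%:R)^-1 (f0 y))).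
have hE y : y != a -> \int[mu]_(r in I01) h r y =
    (truncated_power k.+1 (y - u) / (k.+1)`!%:R
     - truncated_power k.+1 (a - u) / (k.+1)`!%:R) / (y - a).
  move=> ya; have pq : y - u != a - u by rewrite (inj_eq (addIr _)).
  rewrite /h RintegralZr// /Rintegral.
  rewrite (integral_truncated_power_segment k pq) [fine _]/=.
  rewrite factS natrM; move: (k.+1%:R : R) (k`!%:R : R) n0 k0 => n f n0 k0'.
  have ya1 : y - a != 0 by rewrite subr_eq0.
  have ya2 : a - u - (y - u) != 0.
    by rewrite opprB addrA subrK subr_eq0 eq_sym.
  by field; rewrite n0 ya1 ya2 k0'.
have [ii ee] := Rintegral_divided_difference (k.+1) (fun i => x i.+1) ih.
have sE r : I01 r -> divided_difference (h r) k.+1 (fun i => x i.+1) = bspline_slice k x u r.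
  move=> Ir; have /andP[r0 r1] : 0 < r < 1 by move: Ir; rewrite /I01/= in_itv.
  have s0 : 0 < 1 - r by rewrite subr_gt0.
  have s1 : 1 - r != 0 by rewrite gt_eqF.
  rewrite /bspline_slice /bspline -divided_differenceZ; apply: eq_divided_difference => i _ /=.
  rewrite /h mulrA; congr (_ / _).
  rewrite (_ : _ + _ * r = (1 - r) * (x i.+1 - (u - r * x 0%N) / (1 - r))); last first.
    by rewrite /a; field.
  rewrite /truncated_power pmulr_rgt0//; case: ifP; last by rewrite mulr0.
  by rewrite exprMn.
split.
  by apply: (eq_integrable mI _ _ _ ii) => //; move=> r /set_mem Ir; congr EFin; exact: sE.
rewrite /bspline divided_difference_slope// -/a.
transitivity (\int[mu]_(r in I01) divided_difference (h r) k.+1 (fun i => x i.+1)).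
  2: by apply: eq_Rintegral => r /set_mem Ir; rewrite -sE.
rewrite ee; apply: eq_divided_difference => i ik; rewrite hE//.
exact: dx.
Qed.

(** For two knots this is the monotonicity of a step function; the recursion does
    the rest. *)
Lemma bspline_ge0 m (x : nat -> R) u : distinct_knots m.+1 x ->
  0 <= bspline m.+1 x u.
Proof.
elim: m x u => [|k IHk] x u dx.
  have step (y z : R) : y <= z -> truncated_power 0 (y - u) <= truncated_power 0 (z - u).
    rewrite /truncated_power !subr_gt0 => yz; case: ifP => [uy|_].
      by rewrite (lt_le_trans uy yz).
    by case: ifP.
  rewrite /bspline/= divr1 divr1.
  have [x01|x10|x01] := ltgtP (x 0%N) (x 1%N).
  - by rewrite -mulrNN -invrN !opprB divr_ge0// subr_ge0 ?step// ltW.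
  - by rewrite divr_ge0// subr_ge0 ?step// ltW.
  - by rewrite x01 !subrr mul0r.
have [_ ->] := bspline_recursion u dx.
apply: Rintegral_ge0 => r; rewrite /I01/= in_itv/= => /andP[r0 r1].
by rewrite mulr_ge0 ?exprn_ge0 ?subr_ge0 ?(ltW r1)// IHk//; exact: distinct_knotsS.
Qed.

Lemma EFin_bspline_recursion k x u : distinct_knots k.+2 x ->
  (bspline k.+2 x u)%:E = (\int[mu]_(r in I01) (bspline_slice k x u r)%:E)%E.
Proof.
move=> dx; have [ii ->] := bspline_recursion u dx.
have mI : @measurable _ (measurableTypeR R) I01 by exact: measurable_itv.
by rewrite /Rintegral fineK//; exact: (integrable_fin_num mI ii).
Qed.

End bspline_recursion.

(** * Measurability and integration on the torus *)

Section measurable_bspline.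
Context {R : realType} d (X : measurableType d).
Implicit Types (m : nat) (kn : nat -> X -> R).

Lemma measurable_divided_difference (f : X -> R -> R) m kn :
  (forall i, measurable_fun setT (kn i)) ->
  (forall i, measurable_fun setT (fun z => f z (kn i z))) ->
  measurable_fun setT (fun z => divided_difference (f z) m (kn^~ z)).
Proof.
elim: m kn => [|m IHm] kn mk mf; first exact: mf.
apply: measurable_funM.
  apply: measurable_funB; first exact: IHm.
  by apply: (IHm (fun i => kn i.+1)) => i; [exact: mk|exact: mf].
by apply: measurable_fun_inv; exact: measurable_funB.
Qed.

Lemma measurable_bspline m kn (u : X -> R) :
  (forall i, measurable_fun setT (kn i)) -> measurable_fun setT u ->
  measurable_fun setT (fun z => bspline m (kn^~ z) (u z)).
Proof.
move=> mk mu; apply: measurable_divided_difference => // i.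
apply: measurable_funM => //.
apply: measurableT_comp (measurable_truncated_power m.-1) _.
exact: measurable_funB.
Qed.

Lemma measurable_uniq (s : seq (X -> R)) :
  (forall i, measurable_fun setT (nth (cst 0) s i)) ->
  measurable_fun setT (fun z => uniq [seq f z | f <- s]).
Proof.
elim: s => [|f s IHs] ms; first exact: measurable_cst.
have mf : measurable_fun setT f := ms 0%N.
have {}ms i : measurable_fun setT (nth (cst 0) s i) := ms i.+1.
apply: measurable_and; last exact: IHs.
apply: measurable_neg; move: ms; elim: s {IHs} => [|g s IHs] ms.
  exact: measurable_cst.
rewrite (_ : (fun _ => _) = fun z => (f z == g z) || (f z \in [seq h z | h <- s])).
  apply: measurable_or; first exact: measurable_fun_eqr mf (ms 0%N).
  by apply: IHs => i; exact: (ms i.+1).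
by apply/funext => z; rewrite inE.
Qed.

End measurable_bspline.

Section torus_integral.
Local Open Scope ereal_scope.
Context {R : realType}.
Let mu := @lebesgue_measure R.
Let TR := measurableTypeR R.
Let Q := `[0%R, (2 * pi)%R[%classic : set R.

Lemma measurable_torus n : measurable (@torus R n).
Proof.
have mQ (i : 'I_n) : @measurable _ TR Q by exact: measurable_itv.
exact: (@power_measure_box _ TR R mu n (fun=> Q) mQ).1.
Qed.

Lemma integral_lebesgue_tuple_cons n (F : n.+1.-tuple TR -> \bar R) :
  measurable_fun setT F -> (forall t, 0 <= F t) ->
  \int[lebesgue_tuple R n.+1]_(t in @torus R n.+1) F t =
  \int[mu]_(x in Q) \int[lebesgue_tuple R n]_(t in @torus R n) F [tuple of x :: t].
Proof.
move=> mF F0.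
have mc := @measurable_tuple_cons _ TR n.
have mFc : measurable_fun setT (F \o @tuple_cons _ TR n) by exact: measurableT_comp.
have mQ : measurable Q by exact: measurable_itv.
have mT := measurable_torus.
transitivity (\int[mu \x lebesgue_tuple R n]_(z in Q `*` @torus R n) (F \o @tuple_cons _ TR n) z).
  transitivity (\int[pushforward (mu \x lebesgue_tuple R n) (@tuple_cons _ TR n)]_(t in @torus R n.+1) F t).
    exact: eq_measure_integral.
  rewrite ge0_integral_pushforward//.
  - rewrite (_ : _ @^-1` _ = Q `*` @torus R n)//.
    apply/seteqP; split => -[x t]; rewrite /torus/=.
      move=> H; split; first by have := H ord0.
      by move=> i; have := H (lift ord0 i); rewrite tnthS.
    by move=> [xQ tT] i; case: (unliftP ord0 i) => [j|] ->; rewrite ?tnthS.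
  - exact: mT.
  - exact: measurable_funTS.
rewrite integral_mkcond fubini_tonelli1//; last 2 first.
- by apply/(measurable_restrictT _ (measurableX mQ (mT n)))/measurable_funTS.
- by move=> z; rewrite patchE; case: ifP => // _; exact: F0.
rewrite [RHS]integral_mkcond; apply: eq_integral => x _; rewrite patchE /fubini_F.
case: ifPn => xQ.
  rewrite [RHS]integral_mkcond; apply: eq_integral => t _; rewrite !patchE in_setX.
  by rewrite xQ.
by rewrite integral0_eq// => t _; rewrite patchE in_setX (negbTE xQ).
Qed.

Lemma integral_lebesgue_tuple0 (F : 0.-tuple TR -> \bar R) :
  measurable_fun setT F -> (forall t, 0 <= F t) ->
  \int[lebesgue_tuple R 0]_(t in @torus R 0) F t = F [tuple].
Proof.
move=> mF F0; rewrite [LHS](@integral_dirac _ (0.-tuple TR) [tuple] R).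
- by rewrite diracE mem_set ?mul1e// => -[].
- exact: measurable_torus.
- exact: measurable_funTS.
Qed.

Lemma cos_in_negligible (cs : seq R) :
  measurable [set x : R | cos x \in cs] /\
  mu (Q `&` [set x : R | cos x \in cs]) = 0.
Proof.
split.
  rewrite (_ : mkset _ = cos @^-1` [set` cs]); last by apply/seteqP; split.
  rewrite -[X in measurable X]setTI.
  apply: (continuous_measurable_fun (@continuous_cos R)) => //.
  exact/countable_measurable/finite_set_countable/finite_seq.
apply: countable_lebesgue_measure0.
apply: (@sub_countable _ _ _ [set` [seq acos c | c <- cs] ++ [seq (2 * pi - acos c)%R | c <- cs]]).
  apply: subset_card_le => x [xQ /= xc].
  move: xQ; rewrite /Q/= in_itv/= => /andP[x0 x2].
  (* On [0, 2 pi[, [cos x = c] forces [x = acos c] or [x = 2 pi - acos c]. *)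
  rewrite mem_cat; apply/orP; have [xpi|xpi] := leP x pi.
    by left; apply/mapP; exists (cos x) => //; rewrite cosK// in_itv/= x0.
  right; apply/mapP; exists (cos x) => //.
  rewrite -cosN -[cos (- x)%R](cosD2pi) cosK ?in_itv/= ?mulr2n; lra.
exact/finite_set_countable/finite_seq.
Qed.

End torus_integral.

(** * Averaging the recursion *)

Section averaged_bspline.
Local Open Scope ereal_scope.
Context {R : realType}.
Let mu := @lebesgue_measure R.
Let TR := measurableTypeR R.
Let Q := `[0%R, (2 * pi)%R[%classic : set R.
Let I01 := `]0%R, 1%R[%classic : set R.

(** Finitely many values of the cosine are attained on a null set of angles. *)
Lemma eq_integral_off_cos (cs : seq R) (f g : R -> \bar R) :
  measurable_fun setT f -> measurable_fun setT g ->
  (forall x, 0 <= f x) -> (forall x, 0 <= g x) ->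
  (forall x, cos x \notin cs -> f x = g x) ->
  \int[mu]_(x in Q) f x = \int[mu]_(x in Q) g x.
Proof.
move=> mf mg f0 g0 fg; have [mc c0] := cos_in_negligible cs.
have mQ : @measurable _ TR Q by exact: measurable_itv.
apply: ge0_ae_eq_integral => //; [exact: measurable_funTS|exact: measurable_funTS|].
exists (Q `&` [set x | cos x \in cs]); split; [exact: measurableI|exact: c0|].
move=> x /= /not_implyP[Qx fgx]; split => //=.
by apply: contra_notT fgx => /fg.
Qed.

(** The value [-1] is excluded as well as repetitions: then [u = -1] needs no
    special treatment, the step function [0 < cos t - u] being [1] at every angle. *)
Definition generic_angles n (t : n.-tuple TR) :=
  uniq (-1 :: [seq cos (x : R) | x <- t])%R.

Lemma generic_angles_cons n (x : R) (t : n.-tuple TR) :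
  generic_angles [tuple of x :: t] =
  (cos x \notin (-1 :: [seq cos (x : R) | x <- t])%R) && generic_angles t.
Proof.
rewrite /generic_angles /= !inE !negb_or (eq_sym (-1)%R).
by case: (cos x == -1)%R; case: (_ \in _); case: (_ \in _); case: uniq.
Qed.

Lemma generic_angles_distinct n (t : n.+1.-tuple TR) : generic_angles t ->
  distinct_knots n (fun i => cos (nth 0%R t i)).
Proof.
move=> /= /andP[_ ut] i j iln jln ij.
have st : size t = n.+1 by exact: size_tuple.
rewrite -!(nth_map 0%R 0%R cos) ?st//.
by rewrite nth_uniq ?size_map ?st.
Qed.

Lemma measurable_nth_tuple d (X : measurableType d) n (t : X -> n.-tuple TR) i :
  measurable_fun setT t -> measurable_fun setT (fun z => nth 0%R (t z) i : R).
Proof.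
move=> mt; have [iln|nli] := ltnP i n.
  rewrite (_ : (fun _ => _) = (fun s : n.-tuple TR => tnth s (Ordinal iln)) \o t).
    by apply: measurableT_comp mt; exact: measurable_tnth.
  by apply/funext => z /=; rewrite (tnth_nth 0%R).
rewrite (_ : (fun _ => _) = cst 0%R)//; apply/funext => z.
by rewrite nth_default// size_tuple.
Qed.

(** The value [0] at the other angles makes the function nonnegative everywhere, so
    that Tonelli's theorem applies without any integrability. *)
Definition generic_bspline n (t : n.-tuple TR) (u : R) : R :=
  if generic_angles t then bspline n.-1 (fun i => cos (nth 0%R t i)) u else 0%R.

Lemma generic_bspline_ge0 n (t : n.+2.-tuple TR) u : (0 <= generic_bspline t u)%R.
Proof.
rewrite /generic_bspline; case: ifP => // gt.
by apply: bspline_ge0; exact: generic_angles_distinct.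
Qed.

Lemma measurable_cos_nth d (X : measurableType d) n (t : X -> n.-tuple TR) i :
  measurable_fun setT t -> measurable_fun setT (fun z => cos (nth 0%R (t z) i : R)).
Proof.
move=> mt; apply: measurableT_comp (continuous_measurable_fun (@continuous_cos R)) _.
exact: measurable_nth_tuple.
Qed.

Lemma measurable_generic_angles d (X : measurableType d) n (t : X -> n.-tuple TR) :
  measurable_fun setT t -> measurable_fun setT (fun z => generic_angles (t z)).
Proof.
move=> mt.
pose s := cst (-1)%R :: [seq (fun z => cos (nth 0%R (t z) i : R)) | i <- iota 0 n].
rewrite (_ : (fun _ => _) = fun z => uniq [seq f z | f <- s]).
  apply: measurable_uniq => -[|i] /=; first exact: measurable_cst.
  have [iln|nli] := ltnP i n.
    by rewrite (nth_map 0%N) ?size_iota// nth_iota// add0n; exact: measurable_cos_nth.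
  by rewrite nth_default ?size_map ?size_iota//; exact: measurable_cst.
apply/funext => z; rewrite /generic_angles; congr uniq.
rewrite /s /=; congr cons; rewrite -map_comp.
rewrite -[in LHS](mkseq_nth 0%R (t z)) size_tuple /mkseq -map_comp.
by apply: eq_map.
Qed.

Lemma measurable_generic_bspline d (X : measurableType d) n
    (t : X -> n.-tuple TR) (u : X -> R) :
  measurable_fun setT t -> measurable_fun setT u ->
  measurable_fun setT (fun z => generic_bspline (t z) (u z)).
Proof.
move=> mt mu'; apply: measurable_fun_ifT => //; first exact: measurable_generic_angles.
by apply: measurable_bspline => // i; exact: measurable_cos_nth.
Qed.

Definition torus_bspline n (u : R) : \bar R :=
  \int[lebesgue_tuple R n]_(t in @torus R n) (generic_bspline t u)%:E.

(** The recursion for B-splines holds when the new angle avoids finitely many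
    cosines, which depend on the other angles. Integrating the new angle first
    makes this condition disappear; three exchanges of integrals bring the weight
    [r] outside. *)
Lemma torus_bspline_recursion k u : torus_bspline k.+3 u =
  \int[mu]_(x in Q) \int[mu]_(r in I01)
    (((1 - r) ^+ k)%:E * torus_bspline k.+2 ((u - r * cos x) / (1 - r))).
Proof.
have mQ : @measurable _ TR Q by exact: measurable_itv.
have mI : @measurable _ TR I01 by exact: measurable_itv.
have mT n : measurable (@torus R n) by exact: measurable_torus.
have mcons : measurable_fun setT
    (fun z : TR * k.+2.-tuple TR => [tuple of z.1 :: z.2]).
  exact: measurable_tuple_cons.
pose f (z : TR * k.+2.-tuple TR) := (generic_bspline [tuple of z.1 :: z.2] u)%:E.
have f0 z : 0 <= f z by rewrite lee_fin generic_bspline_ge0.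
have mf : measurable_fun setT f.
  by apply/measurable_EFinP; exact: measurable_generic_bspline.
(* The absolute value makes [g] nonnegative for all [r], as Tonelli's theorem
   requires. *)
pose g (z : TR * k.+2.-tuple TR * TR) := (`|1 - z.2 : R| ^+ k *
  generic_bspline z.1.2 ((u - z.2 * cos (z.1.1 : R)) / (1 - z.2)))%R.
have mg : measurable_fun setT g.
  have m12 : measurable_fun setT (fun z : TR * k.+2.-tuple TR * TR => z.1.2).
    exact: measurableT_comp measurable_snd measurable_fst.
  have mc : measurable_fun setT (fun z : TR * k.+2.-tuple TR * TR => cos (z.1.1 : R)).
    apply: measurableT_comp (continuous_measurable_fun (@continuous_cos R)) _.
    exact: measurableT_comp measurable_fst measurable_fst.
  apply: measurable_funM.
    apply: measurable_funX; apply: measurableT_comp (@normr_measurable R setT) _.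
    by apply: measurable_funB => //; exact: measurable_snd.
  apply: measurable_generic_bspline => //; apply: measurable_funM.
    by apply: measurable_funB => //; apply: measurable_funM => //; exact: measurable_snd.
  by apply: measurable_fun_inv; apply: measurable_funB => //; exact: measurable_snd.
have {}mg : measurable_fun setT (EFin \o g) by exact/measurable_EFinP.
have g0 z : 0 <= (EFin \o g) z.
  by rewrite lee_fin mulr_ge0 ?generic_bspline_ge0// exprn_ge0.
pose S (z : TR * k.+2.-tuple TR) := \int[mu]_(r in I01) (EFin \o g) (z, r).
have S0 z : 0 <= S z by exact: integral_ge0.
have mS : measurable_fun setT S by exact: measurable_integral_in.
have fS x (t : k.+2.-tuple TR) : cos x \notin (-1 :: [seq cos (x : R) | x <- t])%R ->
    f (x, t) = S (x, t).
  move=> xt; rewrite /f /S /generic_bspline generic_angles_cons xt /=.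
  case: ifPn => gt; last first.
    by rewrite integral0_eq// => r _; rewrite /g /generic_bspline (negbTE gt) mulr0.
  rewrite EFin_bspline_recursion; last first.
    by apply: generic_angles_distinct; rewrite generic_angles_cons xt.
  apply: eq_integral => r /set_mem; rewrite /I01/= in_itv/= => /andP[r0 r1].
  by rewrite /bspline_slice /g /generic_bspline gt/= ger0_norm// subr_ge0 ltW.
have mfx t : measurable_fun setT (fun x => f (x, t)).
  by apply: measurableT_comp mf _; exact: measurable_fun_pair.
have mSx t : measurable_fun setT (fun x => S (x, t)).
  by apply: measurableT_comp mS _; exact: measurable_fun_pair.
transitivity (\int[mu]_(x in Q) \int[lebesgue_tuple R k.+2]_(t in @torus R k.+2) f (x, t)).
  rewrite /torus_bspline integral_lebesgue_tuple_cons//.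
  - by apply/measurable_EFinP; exact: measurable_generic_bspline.
  - by move=> t; rewrite lee_fin generic_bspline_ge0.
rewrite (tonelli_in mu (lebesgue_tuple R k.+2) mQ (mT _) mf f0).
transitivity (\int[lebesgue_tuple R k.+2]_(t in @torus R k.+2) \int[mu]_(x in Q) S (x, t)).
  apply: eq_integral => t _.
  by apply: (@eq_integral_off_cos (-1 :: [seq cos (x : R) | x <- t])%R _ _
    (mfx t) (mSx t)) => // x; exact: fS.
rewrite -(tonelli_in mu (lebesgue_tuple R k.+2) mQ (mT _) mS S0); apply: eq_integral => x _.
pose gx (z : k.+2.-tuple TR * TR) := (EFin \o g) (x, z.1, z.2).
have mgx : measurable_fun setT gx.
  apply: measurableT_comp mg _; apply: measurable_fun_pair; last exact: measurable_snd.
  by apply: measurable_fun_pair => //; exact: measurable_fst.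
transitivity (\int[mu]_(r in I01) \int[lebesgue_tuple R k.+2]_(t in @torus R k.+2) gx (t, r)).
  by apply: (tonelli_in (lebesgue_tuple R k.+2) mu (mT _) mI mgx) => z; exact: g0.
apply: eq_integral => r /set_mem; rewrite /I01/= in_itv/= => /andP[r0 r1].
have s0 : (0 <= 1 - r)%R by rewrite subr_ge0 ltW.
transitivity (\int[lebesgue_tuple R k.+2]_(t in @torus R k.+2)
  (((1 - r) ^+ k)%:E * (generic_bspline t ((u - r * cos x) / (1 - r)))%:E)).
  by apply: eq_integral => t _; rewrite /gx /g /= ger0_norm.
apply: ge0_integralZl => //.
- exact: mT.
- by apply/measurable_EFinP/measurable_funTS; exact: measurable_generic_bspline.
- by move=> t _; rewrite lee_fin generic_bspline_ge0.
- by rewrite lee_fin exprn_ge0.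
Qed.

End averaged_bspline.

(** * Two knots *)

Section two_angles.
Local Open Scope ereal_scope.
Context {R : realType}.
Let mu := @lebesgue_measure R.
Let TR := measurableTypeR R.
Let Q := `[0%R, (2 * pi)%R[%classic : set R.
Implicit Types a b u x y : R.

(** The B-spline with the two knots [a] and [b]. *)
Definition pair_kernel a b u : R :=
  if [&& a != -1, b != -1 & a != b]%R
  then ((truncated_power 0 (a - u) - truncated_power 0 (b - u)) / (a - b))%R
  else 0%R.

Lemma pair_kernel_ge0 a b u : (0 <= pair_kernel a b u)%R.
Proof.
rewrite /pair_kernel; case: ifP => // /and3P[_ _ ab].
have := @bspline_ge0 R 0 (fun i => if i is 0%N then a else b) u.
rewrite /bspline /= !divr1; apply.
by case=> [|[|//]] [|[|//]] //= _ _ _; rewrite eq_sym.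
Qed.

Lemma measurable_pair_kernel d (X : measurableType d) (a b u : X -> R) :
  measurable_fun setT a -> measurable_fun setT b -> measurable_fun setT u ->
  measurable_fun setT (fun z => (pair_kernel (a z) (b z) (u z))%:E).
Proof.
move=> ma mb mu'; apply/measurable_EFinP; apply: measurable_fun_ifT => //.
  apply: measurable_and; first by apply: measurable_neg; exact: measurable_fun_eqr.
  by apply: measurable_and; apply: measurable_neg; exact: measurable_fun_eqr.
apply: measurable_funM; last by apply: measurable_fun_inv; exact: measurable_funB.
by apply: measurable_funB; apply: measurableT_comp (measurable_truncated_power 0) _;
  exact: measurable_funB.
Qed.

Lemma torus_bspline2 u : torus_bspline 2 u =
  \int[mu]_(x in Q) \int[mu]_(y in Q) (pair_kernel (cos x) (cos y) u)%:E.
Proof.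
have mg n (t : TR) : measurable_fun setT (fun s : n.-tuple TR =>
    generic_bspline [tuple of t :: s] u).
  by apply: measurable_generic_bspline => //; exact: measurable_cons.
rewrite /torus_bspline integral_lebesgue_tuple_cons//; last 2 first.
- by apply/measurable_EFinP; exact: measurable_generic_bspline.
- by move=> t; rewrite lee_fin generic_bspline_ge0.
apply: eq_integral => x _.
rewrite integral_lebesgue_tuple_cons//; last 2 first.
- by apply/measurable_EFinP; exact: mg.
- by move=> t; rewrite lee_fin generic_bspline_ge0.
apply: eq_integral => y _.
rewrite integral_lebesgue_tuple0//; last 2 first.
- apply/measurable_EFinP; apply: measurable_generic_bspline => //.
  by apply: measurable_cons => //; exact: measurable_cons.
- by move=> t; rewrite lee_fin generic_bspline_ge0.
rewrite /generic_bspline /pair_kernel /generic_angles /= !inE negb_or !andbT.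
by rewrite !(eq_sym (-1)%R) -andbA /bspline/= !divr1.
Qed.

(** [pair_kernel] times the two densities of the half-angle substitution. *)
Let scaled_kernel u x y : R :=
  if [&& x != 0, y != 0 & x ^+ 2 != y ^+ 2]%R
  then (2 * (truncated_power 0 ((1 - u) * x ^+ 2 - (1 + u))
             - truncated_power 0 ((1 - u) * y ^+ 2 - (1 + u)))
        / (x ^+ 2 - y ^+ 2))%R
  else 0%R.

Let cy x : R := ((x ^+ 2 - 1) / (x ^+ 2 + 1))%R.

Let scaled_kernelE u x y : (pair_kernel (cy x) (cy y) u *
  (2 / (1 + y ^+ 2)) * (2 / (1 + x ^+ 2)))%R = scaled_kernel u x y.
Proof.
have pos (z : R) : (0 < z ^+ 2 + 1)%R by have := sqr_ge0 z; lra.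
have neq (z : R) : (z ^+ 2 + 1 != 0)%R by rewrite gt_eqF.
have cN1 (z : R) : (cy z == -1)%R = (z == 0)%R.
  rewrite -subr_eq0 (_ : (cy z - -1) = 2 * z ^+ 2 / (z ^+ 2 + 1))%R; last first.
    by rewrite /cy; field.
  by rewrite !mulf_eq0 invr_eq0 (negbTE (neq z)) orbF pnatr_eq0 orbb.
have cB : (cy x - cy y = 2 * (x ^+ 2 - y ^+ 2) / ((x ^+ 2 + 1) * (y ^+ 2 + 1)))%R.
  by rewrite /cy; field; rewrite !neq.
have ceq : (cy x == cy y)%R = (x ^+ 2 == y ^+ 2)%R.
  rewrite -subr_eq0 cB !mulf_eq0 invr_eq0 mulf_eq0 !(negbTE (neq _)) orbF.
  by rewrite pnatr_eq0/= orbF subr_eq0.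
have tc (z : R) : truncated_power 0 (cy z - u) =
    truncated_power 0 ((1 - u) * z ^+ 2 - (1 + u)).
  rewrite (_ : (cy z - u) = ((1 - u) * z ^+ 2 - (1 + u)) / (z ^+ 2 + 1))%R; last first.
    by rewrite /cy; field.
  by rewrite /truncated_power pmulr_lgt0 ?invr_gt0.
rewrite /pair_kernel /scaled_kernel !cN1 ceq !tc.
case: ifP => [/and3P[_ _]|_]; last by rewrite !mul0r.
rewrite -subr_eq0 => xy; rewrite cB !(addrC 1%R).
by field; rewrite xy !neq.
Qed.

Let scaled_kernel_ge0 u x y : (0 <= scaled_kernel u x y)%R.
Proof.
rewrite -scaled_kernelE !mulr_ge0 ?pair_kernel_ge0 ?invr_ge0//.
  by have := sqr_ge0 y; lra.
by have := sqr_ge0 x; lra.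
Qed.

Let measurable_cy d (X : measurableType d) (f : X -> R) :
  measurable_fun setT f -> measurable_fun setT (fun z => cy (f z)).
Proof.
move=> mf; apply: measurable_funM.
  by apply: measurable_funB => //; exact: measurable_funX.
by apply: measurable_fun_inv; apply: measurable_funD => //; exact: measurable_funX.
Qed.

Let measurable_weight d (X : measurableType d) (f : X -> R) :
  measurable_fun setT f -> measurable_fun setT (fun z => 2 / (1 + f z ^+ 2))%R.
Proof.
move=> mf; apply: measurable_funM => //; apply: measurable_fun_inv.
by apply: measurable_funD => //; exact: measurable_funX.
Qed.

Let measurable_scaled_kernel d (X : measurableType d) u (f g : X -> R) :
  measurable_fun setT f -> measurable_fun setT g ->
  measurable_fun setT (fun z => (scaled_kernel u (f z) (g z))%:E).
Proof.
move=> mf mg; under eq_fun do rewrite -scaled_kernelE.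
apply/measurable_EFinP; apply: measurable_funM; last exact: measurable_weight.
apply: measurable_funM; last exact: measurable_weight.
by apply/measurable_EFinP; apply: measurable_pair_kernel => //; exact: measurable_cy.
Qed.

Let torus_bspline2_scaled u : torus_bspline 2 u =
  \int[mu]_x \int[mu]_y (scaled_kernel u x y)%:E.
Proof.
have mQ : @measurable _ TR Q by exact: measurable_itv.
have mcos : measurable_fun [set: R] cos.
  exact: (continuous_measurable_fun (@continuous_cos R)).
rewrite torus_bspline2.
pose F a := \int[mu]_(y in Q) (pair_kernel a (cos y) u)%:E.
have F0 a : 0 <= F a by apply: integral_ge0 => y _; rewrite lee_fin pair_kernel_ge0.
have mF : measurable_fun setT F.
  apply: (@measurable_integral_in R _ _ TR TR mu Q
    (fun z => (pair_kernel z.1 (cos (z.2 : R)) u)%:E)) => //.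
  - apply: (@measurable_pair_kernel _ _ fst (fun z => cos (z.2 : R)) (cst u)) => //.
    by apply: measurableT_comp mcos _; exact: measurable_snd.
  - by move=> z; rewrite lee_fin pair_kernel_ge0.
rewrite [LHS](ge0_integral_cos mF F0); apply: eq_integral => x _.
have mpk : measurable_fun setT (fun b : R => (pair_kernel (cy x) b u)%:E).
  exact: measurable_pair_kernel.
have pk0 b : 0 <= (pair_kernel (cy x) b u)%:E by rewrite lee_fin pair_kernel_ge0.
rewrite /F -/(cy x) (ge0_integral_cos mpk pk0).
transitivity (\int[mu]_y ((pair_kernel (cy x) (cy y) u)%:E * (2 / (1 + y ^+ 2))%:E
   * (2 / (1 + x ^+ 2))%:E)); last first.
  by apply: eq_integral => y _; rewrite -scaled_kernelE.
apply/esym; apply: ge0_integralZr => //.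
- apply: emeasurable_funM.
    by apply: measurable_pair_kernel => //; exact: (@measurable_cy _ _ id).
  by apply/measurable_EFinP; exact: (@measurable_weight _ _ id).
- move=> y _; rewrite mule_ge0 ?lee_fin ?pair_kernel_ge0// divr_ge0//.
  by have := sqr_ge0 y; lra.
- by rewrite lee_fin divr_ge0//; have := sqr_ge0 x; lra.
Qed.

(** In half-angle coordinates the steps are located at
    [x^2 = (1 + u) / (1 - u)], and [dx dy / (x^2 - y^2)] is invariant under
    dilations; so the average is constant for [-1 < u < 1]. *)
Lemma torus_bspline2_shape u :
  torus_bspline 2 u = (gegenbauer_weight 0 u)%:E * torus_bspline 2 0.
Proof.
have out : (1 <= u)%R \/ (u <= -1)%R -> torus_bspline 2 u =
    (gegenbauer_weight 0 u)%:E * torus_bspline 2 0.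
  move=> u1; rewrite /gegenbauer_weight.
  rewrite [X in X%:E * _](_ : _ = 0%R); last first.
    by case: u1 => u1; [rewrite half_power_le0 ?mul0r//|
      rewrite [X in (_ * X)%R]half_power_le0 ?mulr0//]; lra.
  rewrite mul0e torus_bspline2 integral0_eq// => x _; rewrite integral0_eq// => y _.
  rewrite /pair_kernel; case: ifP => // /and3P[x1 y1 _]; rewrite /truncated_power.
  have cgt (z : R) : (cos z != -1)%R -> (-1 < cos z)%R by move=> z1; rewrite lt_neqAle eq_sym z1 cos_geN1.
  case: u1 => u1; last first.
    by rewrite !subr_gt0 !(le_lt_trans u1) ?cgt// subrr mul0r.
  by rewrite !subr_gt0 !ltNge !(le_trans (cos_le1 _) u1)/= subrr mul0r.
have [u1|u1] := leP 1%R u; first by apply: out; left.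
have [u2|u2] := leP u (-1)%R; first by apply: out; right.
have A0 : (0 < 1 - u)%R by lra.
have B0 : (0 < 1 + u)%R by lra.
rewrite /gegenbauer_weight !half_power_gt0E// !expr0 mulr1 mul1e.
rewrite !torus_bspline2_scaled.
pose l := Num.sqrt ((1 + u) / (1 - u)).
have l0 : (0 < l)%R by rewrite sqrtr_gt0 divr_gt0.
have l2 : (l ^+ 2 = (1 + u) / (1 - u))%R by rewrite sqr_sqrtr// divr_ge0// ltW.
have sE x y : (scaled_kernel u (l * x + 0) (l * y + 0) = l ^- 2 * scaled_kernel 0 x y)%R.
  rewrite /scaled_kernel !addr0 !mulf_eq0 (gt_eqF l0)/= !exprMn.
  have ll : (l ^+ 2 != 0)%R by rewrite gt_eqF// exprn_gt0.
  rewrite (inj_eq (mulfI ll)).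
  case: ifP => [/and3P[_ _]|_]; last by rewrite mulr0.
  rewrite -subr_eq0 => xy.
  have tE (z : R) : truncated_power 0 ((1 - u) * (l ^+ 2 * z ^+ 2) - (1 + u)) =
      truncated_power 0 ((1 - 0) * z ^+ 2 - 1).
    rewrite l2 (_ : (_ * (_ * _) - _) = (1 + u) * ((1 - 0) * z ^+ 2 - 1))%R; last first.
      by field; rewrite gt_eqF.
    by rewrite /truncated_power pmulr_rgt0.
  rewrite !tE; field; rewrite xy.
  by rewrite (gt_eqF l0) /= !exprMn -mulrBr mulf_neq0.
pose G x := \int[mu]_y (scaled_kernel u x y)%:E.
have G0 x : 0 <= G x by apply: integral_ge0 => y _; rewrite lee_fin scaled_kernel_ge0.
have mG : measurable_fun setT G.
  apply: (@measurable_integral_in R _ _ TR TR mu setT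
    (fun z => (scaled_kernel u z.1 z.2)%:E)) => //.
  - by apply: measurable_scaled_kernel; [exact: measurable_fst|exact: measurable_snd].
  - by move=> z; rewrite lee_fin scaled_kernel_ge0.
have scale (f : R -> \bar R) : measurable_fun setT f -> (forall x, 0 <= f x) ->
    \int[mu]_x f x = l%:E * \int[mu]_x f (l * x + 0)%R.
  move=> mf f0; rewrite (ge0_integral_affine 0%R (lt0r_neq0 l0) mf f0).
  by rewrite gtr0_norm// muleA -EFinM divff ?mul1e// gt_eqF.
rewrite [LHS](scale G mG G0).
transitivity (l%:E * \int[mu]_x (l^-1%:E * \int[mu]_y (scaled_kernel 0 x y)%:E)).
  congr (_ * _); apply: eq_integral => x _; rewrite /G.
  rewrite (scale (fun y => (scaled_kernel u (l * x + 0) y)%:E)); last 2 first.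
  - exact: measurable_scaled_kernel.
  - by move=> y; rewrite lee_fin scaled_kernel_ge0.
  transitivity (l%:E * ((l ^- 2)%:E * \int[mu]_y (scaled_kernel 0 x y)%:E)).
    congr (_ * _).
    transitivity (\int[mu]_y ((l ^- 2)%:E * (scaled_kernel 0 x y)%:E)).
      by apply: eq_integral => y _; rewrite sE.
    apply: ge0_integralZl => //.
    - exact: measurable_scaled_kernel.
    - by move=> y _; rewrite lee_fin scaled_kernel_ge0.
    - by rewrite lee_fin invr_ge0 exprn_ge0// ltW.
  rewrite muleA -EFinM; congr (_%:E * _); field; exact: lt0r_neq0.
have mG0 : measurable_fun setT (fun x => \int[mu]_y (scaled_kernel 0 x y)%:E).
  apply: (@measurable_integral_in R _ _ TR TR mu setT
    (fun z => (scaled_kernel 0 z.1 z.2)%:E)) => //.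
  - by apply: measurable_scaled_kernel; [exact: measurable_fst|exact: measurable_snd].
  - by move=> z; rewrite lee_fin scaled_kernel_ge0.
transitivity (l%:E * (l^-1%:E * \int[mu]_x \int[mu]_y (scaled_kernel 0 x y)%:E)).
  congr (_ * _); apply: ge0_integralZl => //.
  - by move=> x _; apply: integral_ge0 => y _; rewrite lee_fin scaled_kernel_ge0.
  - by rewrite lee_fin invr_ge0 ltW.
by rewrite muleA -EFinM divff ?mul1e// gt_eqF.
Qed.

End two_angles.

(** * The averaged B-spline in closed form *)

Section torus_bspline_formula.
Local Open Scope ereal_scope.
Context {R : realType}.
Let mu := @lebesgue_measure R.
Let TR := measurableTypeR R.
Let Q := `[0%R, (2 * pi)%R[%classic : set R.
Implicit Types a b u x y : R.

(** A B-spline with two knots is the uniform density between them. *)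
Lemma integral_pair_kernel a b :
  \int[mu]_u (pair_kernel a b u)%:E =
  (if [&& a != -1, b != -1 & a != b]%R then 1%R else 0%R)%:E.
Proof.
rewrite /pair_kernel; case: ifP => [/and3P[_ _ ab]|_]; last exact: integral0.
have itv p q : (p < q)%R -> \int[mu]_u ((q - p)^-1 * \1_(`[p, q[%classic : set R) u)%:E = 1.
  move=> pq; under eq_integral do rewrite EFinM.
  rewrite ge0_integralZl//; last 2 first.
  - by apply/measurable_EFinP; exact: measurable_indic.
  - by rewrite lee_fin invr_ge0 subr_ge0 ltW.
  rewrite integral_indic// setIT /= lebesgue_measure_itv/= lte_fin pq -EFinB -EFinM.
  by rewrite mulVf// subr_eq0 gt_eqF.
have step p q u : (p < q)%R -> ((truncated_power 0 (p - u) - truncated_power 0 (q - u)) / (p - q)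
    = (q - p)^-1 * \1_(`[p, q[%classic : set R) u)%R.
  move=> pq; rewrite indicE mem_setE in_itv/= /truncated_power !subr_gt0 !expr0.
  rewrite -[in RHS](opprB p q) invrN mulNr -mulrN mulrC; congr (_ * _)%R.
  have [up|pu] := ltP u p; first by rewrite (lt_trans up pq) subrr oppr0.
  by case: ifP => _; rewrite sub0r.
have [ab'|ba|abE] := ltgtP a b; last by rewrite abE eqxx in ab.
  by rewrite -(itv _ _ ab'); apply: eq_integral => u _; rewrite -step.
rewrite -(itv _ _ ba); apply: eq_integral => u _; rewrite -step//.
by congr EFin; rewrite -[RHS]mulrNN -invrN !opprB.
Qed.

Lemma integral_period_cst c : \int[mu]_(x in Q) (cst c x) = c * (2 * pi)%:E.
Proof.
rewrite integral_cst//=; last exact: measurable_itv.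
by rewrite lebesgue_measure_itv/= lte_fin mulr_gt0 ?pi_gt0// sube0.
Qed.

Lemma integral_torus_bspline2 : \int[mu]_u torus_bspline 2 u = ((2 * pi) ^+ 2)%:E.
Proof.
have mQ : @measurable _ TR Q by exact: measurable_itv.
have mcos : measurable_fun [set: R] cos.
  exact: (continuous_measurable_fun (@continuous_cos R)).
have twopi0 : (0 <= 2 * pi :> R)%R by rewrite mulr_ge0// pi_ge0.
pose f (z : R * R * R) := (pair_kernel (cos z.1.2) (cos z.2) z.1.1)%:E.
have f0 z : 0 <= f z by rewrite lee_fin pair_kernel_ge0.
have mf : measurable_fun setT f.
  apply: (@measurable_pair_kernel _ _ _ (fun z : R * R * R => cos z.1.2) (fun z => cos z.2)
    (fun z => z.1.1)).
  - apply: measurableT_comp mcos _; exact: measurableT_comp measurable_snd measurable_fst.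
  - by apply: measurableT_comp mcos _; exact: measurable_snd.
  - exact: measurableT_comp measurable_fst measurable_fst.
pose F (z : R * R) := \int[mu]_(y in Q) f (z, y).
have F0 z : 0 <= F z by exact: integral_ge0.
have mF : measurable_fun setT F by exact: (@measurable_integral_in R _ _ _ TR mu Q f).
under eq_integral do rewrite torus_bspline2.
transitivity (\int[mu]_(x in Q) \int[mu]_u F (u, x)).
  exact: (@tonelli_in R _ _ TR TR mu mu setT Q F).
pose ind (t : bool) : R := if t then 1%R else 0%R.
have ind0 t : 0 <= (ind t)%:E by rewrite lee_fin /ind; case: ifP.
transitivity (\int[mu]_(x in Q) ((ind (cos x != -1)%R)%:E * (2 * pi)%:E)).
  apply: eq_integral => x _.
  pose g (z : R * R) := f (z.1, x, z.2).
  have mg : measurable_fun setT g.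
    apply: measurableT_comp mf _; apply: measurable_fun_pair; last exact: measurable_snd.
    by apply: measurable_fun_pair => //; exact: measurable_fst.
  transitivity (\int[mu]_(y in Q) \int[mu]_u g (u, y)).
    by apply: (@tonelli_in R _ _ TR TR mu mu setT Q g) => // z; exact: f0.
  rewrite -integral_period_cst.
  apply: (@eq_integral_off_cos R [:: cos x; (-1)%R]) => //.
  - apply: (@measurable_integral_in R _ _ TR TR mu setT (fun z => g (z.2, z.1))) => //.
      by apply: measurableT_comp mg _; apply: measurable_fun_pair;
        [exact: measurable_snd|exact: measurable_fst].
    by move=> z; exact: f0.
  - by move=> y; apply: integral_ge0 => u _; exact: f0.
  - by move=> y; exact: ind0.
  move=> y; rewrite !inE negb_or eq_sym => /andP[yx y1].
  by rewrite /g /f /= integral_pair_kernel y1 yx !andbT.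
transitivity (\int[mu]_(x in Q) (cst ((2 * pi)%:E) x)).
  apply: (@eq_integral_off_cos R [:: (-1)%R]) => //.
  - apply: emeasurable_funM => //; apply/measurable_EFinP.
    apply: measurable_fun_ifT => //; apply: measurable_neg.
    exact: measurable_fun_eqr.
  - by move=> x; rewrite mule_ge0.
  - by move=> x; rewrite inE => ->; rewrite mul1e.
by rewrite integral_period_cst -EFinM expr2.
Qed.

Definition weight_massR n : R := fine (weight_mass n).

Lemma EFin_weight_massR n : (weight_massR n)%:E = weight_mass n.
Proof.
by rewrite fineK// ge0_fin_numE ?weight_mass_lty// ltW// weight_mass_gt0.
Qed.

Lemma weight_massR_gt0 n : (0 < weight_massR n)%R.
Proof. by rewrite -lte_fin EFin_weight_massR weight_mass_gt0. Qed.

(** A function proportional to the weight is determined by its total mass. *)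
Lemma normalise_shape n (g : R -> \bar R) (c : R) :
  (forall u, 0 <= g u) ->
  (forall u, g u = (gegenbauer_weight n u)%:E * g 0%R) ->
  \int[mu]_u g u = c%:E ->
  forall u, g u = (c / weight_massR n * gegenbauer_weight n u)%:E.
Proof.
move=> g0 gE gI u; have w0 := weight_massR_gt0 n.
have : \int[mu]_u g u = weight_mass n * g 0%R.
  under eq_integral do rewrite gE.
  apply: ge0_integralZr => //.
  - by apply/measurable_EFinP; exact: measurable_gegenbauer_weight.
  - by move=> v _; rewrite lee_fin gegenbauer_weight_ge0.
rewrite gI -EFin_weight_massR (gE u).
case: (g 0%R) (g0 0%R) => [r _|_|//].
  rewrite -!EFinM => -[->]; congr EFin; field; exact: lt0r_neq0.
by rewrite gt0_muley ?lte_fin.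
Qed.

Lemma averaged_weightE n u : averaged_weight n u =
  (2 * pi / n.+2%:R * weight_massR n / weight_massR n.+1 * gegenbauer_weight n.+1 u)%:E.
Proof.
apply: (normalise_shape (g := averaged_weight n)).
- move=> v; apply: integral_ge0 => x _; apply: integral_ge0 => r _.
  by rewrite lee_fin !mulr_ge0// half_power_ge0.
- exact: averaged_weight_shape.
- by rewrite integral_averaged_weight -EFin_weight_massR -EFinM.
Qed.

(** The angle removed last is averaged by [averaged_weightE]; the masses of
    consecutive weights telescope. *)
Lemma torus_bsplineE n u : torus_bspline n.+2 u =
  ((2 * pi) ^+ n.+2 / (n.+1)`!%:R / weight_massR n * gegenbauer_weight n u)%:E.
Proof.
elim: n u => [|n IHn] u.
  rewrite divr1; apply: (normalise_shape (g := torus_bspline 2)).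
  - move=> v; rewrite torus_bspline2; apply: integral_ge0 => x _.
    by apply: integral_ge0 => y _; rewrite lee_fin pair_kernel_ge0.
  - exact: torus_bspline2_shape.
  - exact: integral_torus_bspline2.
set A := ((2 * pi) ^+ n.+2 / (n.+1)`!%:R / weight_massR n)%R in IHn.
have pi0 := pi_gt0 R; have w0 := weight_massR_gt0 n; have w1 := weight_massR_gt0 n.+1.
have A0 : (0 <= A)%R.
  by rewrite !divr_ge0 ?exprn_ge0 ?mulr_ge0 ?ltW.
rewrite torus_bspline_recursion.
pose h (z : TR * TR) : \bar R := (half_power 0 z.2 *
  (half_power n (1 - u - (1 - cos (z.1 : R)) * z.2)
   * half_power n (1 + u - (1 + cos (z.1 : R)) * z.2)))%:E.
have h0 z : 0 <= h z by rewrite lee_fin !mulr_ge0// half_power_ge0.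
have mcos : measurable_fun setT (fun z : TR * TR => cos (z.1 : R)).
  apply: measurableT_comp (continuous_measurable_fun (@continuous_cos R)) _.
  exact: measurable_fst.
have mh : measurable_fun setT h by rewrite /h; measurable_real.
have mhx x : measurable_fun setT (fun r => h (x, r)).
  by apply: measurableT_comp mh _; exact: measurable_fun_pair.
transitivity (A%:E * averaged_weight n u).
  rewrite /averaged_weight.
  transitivity (\int[mu]_(x in Q) (A%:E * \int[mu]_r h (x, r))).
    apply: eq_integral => x _.
    transitivity (\int[mu]_r (A%:E * h (x, r))); last first.
      by apply: ge0_integralZl.
    rewrite integral_mkcond; apply: eq_integral => r _; rewrite patchE mem_setE in_itv/=.
    rewrite /h /=; have [r0|r0] := leP r 0%R.
      by rewrite half_power_le0// mul0r mule0.
    have [r1|r1] := ltP r 1%R; last by rewrite half_power_slice_out// mulr0 mule0.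
    rewrite half_power_gt0E// expr0 mul1r -gegenbauer_weight_slice ?r0//.
    by rewrite IHn -!EFinM; congr EFin; ring.
  apply: ge0_integralZl => //; first exact: measurable_itv.
  - apply: measurable_funTS.
    exact: (@measurable_integral_in R _ _ TR TR mu setT h).
  - by move=> x _; exact: integral_ge0.
rewrite averaged_weightE -EFinM; congr EFin.
rewrite /A (factS n.+1) natrM (exprSr _ n.+2).
have f0 : ((n.+1)`!%:R != 0 :> R)%R by rewrite pnatr_eq0 -lt0n fact_gt0.
have n0 : (n.+2%:R != 0 :> R)%R by rewrite pnatr_eq0.
move: (n.+2%:R : R)%R ((n.+1)`!%:R : R)%R n0 f0 => N f n0 f0.
by field; rewrite f0 n0 !gt_eqF.
Qed.

End torus_bspline_formula.

Section almost_every_angle.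
Local Open Scope ereal_scope.
Context {R : realType}.
Let mu := @lebesgue_measure R.
Let TR := measurableTypeR R.
Let Q := `[0%R, (2 * pi)%R[%classic : set R.

(** Given the other angles, a new angle spoils genericity only by hitting finitely
    many cosines. *)
Lemma integral_nongeneric n : \int[lebesgue_tuple R n]_(t in @torus R n)
  (if generic_angles t then 0%R else 1%R : R)%:E = 0.
Proof.
have mQ : @measurable _ TR Q by exact: measurable_itv.
have mT m : measurable (@torus R m) by exact: measurable_torus.
have mind m d (X : measurableType d) (t : X -> m.-tuple TR) : measurable_fun setT t ->
    measurable_fun setT (fun z => (if generic_angles (t z) then 0%R else 1%R : R)%:E).
  move=> mt; apply/measurable_EFinP; apply: measurable_fun_ifT => //.
  exact: measurable_generic_angles.
have ind0 m (t : m.-tuple TR) : 0 <= (if generic_angles t then 0%R else 1%R : R)%:E.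
  by case: ifP; rewrite lee_fin.
elim: n => [|n IHn].
  by rewrite integral_lebesgue_tuple0//; exact: mind.
rewrite integral_lebesgue_tuple_cons//; last exact: mind.
pose f (z : TR * n.-tuple TR) : \bar R :=
  (if generic_angles [tuple of z.1 :: z.2] then 0%R else 1%R : R)%:E.
have mf : measurable_fun setT f by apply: mind; exact: measurable_tuple_cons.
rewrite (tonelli_in mu (lebesgue_tuple R n) mQ (mT n) mf (fun=> ind0 _ _)).
transitivity (\int[lebesgue_tuple R n]_(t in @torus R n)
    ((if generic_angles t then 0%R else 1%R : R)%:E * (2 * pi)%:E)).
  apply: eq_integral => t _; rewrite -integral_period_cst.
  apply: (@eq_integral_off_cos R (-1 :: [seq cos (x : R) | x <- t])%R) => //.
  - by apply: measurableT_comp mf _; exact: measurable_fun_pair.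
  - by move=> x; exact: ind0.
  - by move=> x; exact: ind0.
  - by move=> x xt; rewrite /f generic_angles_cons xt.
rewrite (_ : \int[_]_(t in _) _ = \int[lebesgue_tuple R n]_(t in @torus R n)
    (if generic_angles t then 0%R else 1%R : R)%:E * (2 * pi)%:E).
  by rewrite IHn mul0e.
apply: ge0_integralZr => //.
- exact: mT.
- by apply: measurable_funTS; exact: mind.
- by rewrite lee_fin mulr_ge0// pi_ge0.
Qed.

(** The two integrands agree at generic angles. *)
Lemma m0_torus_bspline n (u : R) :
  m0 n u = ((2 * pi) ^- n)%:E * torus_bspline n u.
Proof.
rewrite /m0; congr (_ * _).
have mT : measurable (@torus R n) by exact: measurable_torus.
have mG : measurable [set t : n.-tuple TR | ~~ generic_angles t].
  have mg : measurable_fun setT (fun t : n.-tuple TR => ~~ generic_angles t).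
    by apply: measurable_neg; exact: measurable_generic_angles.
  by rewrite -[X in measurable X]setTI; exact: (mg measurableT [set true]).
apply: ae_eq_integral => //.
- apply/measurable_EFinP/measurable_funTS; apply: measurable_bspline => // i.
  exact: measurable_cos_nth.
- by apply/measurable_EFinP/measurable_funTS; exact: measurable_generic_bspline.
exists (@torus R n `&` [set t : n.-tuple TR | ~~ generic_angles t]); split.
- exact: measurableI.
- rewrite setIC -(integral_indic _ mT mG) -(integral_nongeneric n).
  apply: eq_integral => t _; rewrite indicE; congr EFin.
  case: ifPn => gt; first by rewrite memNset//= gt.
  by rewrite mem_set.
- move=> t /= /not_implyP[tT ne]; split => //=; apply: contra_notN ne => gt.
  by rewrite /generic_bspline gt.
Qed.

End almost_every_angle.

Theorem theorem3p7 (R : realType) (d : nat) (u : R) :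
  (2 < d)%N -> -1 <= u <= 1 ->
  m0 d u =
  (Gamma ((d%:R + 1) / 2) / (Num.sqrt pi * Gamma (d%:R / 2) * (d.-1)`!%:R)
   * (1 - u ^+ 2) `^ ((d%:R - 2) / 2))%:E.
Proof.
case: d => [|[|[|n]]]// _ /andP[u1 u2].
rewrite m0_torus_bspline torus_bsplineE -EFinM; congr EFin.
have := EFin_weight_massR (R := R) n.+1; rewrite weight_massE => -[wE].
have w0 := weight_massR_gt0 (R := R) n.+1.
have s0 : 0 < Num.sqrt pi :> R by rewrite sqrtr_gt0 pi_gt0.
have G0 k : 0 < Gamma (k.+2%:R / 2) :> R.
  by rewrite -lte_fin Gamma_half; case/andP: (gamma_half_fin_gt0 (R := R) k).
have gE : gegenbauer_weight n.+1 u = (1 - u ^+ 2) `^ ((n.+3%:R - 2) / 2).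
  rewrite gegenbauer_weightE -[n.+3]addn2 natrD addrK.
  have : 0 <= 1 - u ^+ 2 by nra.
  rewrite le_eqVlt => /predU1P[<-|v0].
    by rewrite half_power_le0// powR0// mulf_neq0// ?pnatr_eq0// invr_neq0// pnatr_eq0.
  move: (1 - u ^+ 2) v0 => v v0.
  rewrite half_power_gt0E// -powR12_sqrt ?ltW// -powR_mulrn ?powR_ge0// -powRrM.
  by congr (_ `^ _); rewrite mulrC.
rewrite -gE (_ : n.+3%:R + 1 = n.+4%:R); last by rewrite -[n.+4]addn1 natrD.
rewrite wE.
have f0 : (n.+2)`!%:R != 0 :> R by rewrite pnatr_eq0 -lt0n fact_gt0.
have p0 : 2 * pi != 0 :> R by rewrite mulf_neq0 ?pnatr_eq0// gt_eqF// pi_gt0.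
have pn0 : (2 * pi) ^+ n.+3 != 0 :> R by rewrite expf_neq0.
have := G0 n.+1; have := G0 n.+2; rewrite [(n.+3).-1]/=.
move: (Gamma (n.+3%:R / 2)) (Gamma (n.+4%:R / 2)) => a b b0 a0.
move: ((2 * pi) ^+ n.+3) pn0 => P P0; move: ((n.+2)`!%:R : R) f0 => f f0.
by field; rewrite P0 f0 !gt_eqF.
Qed.
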